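(* Let $f:\mathbb{R}^d\to\mathbb{R}$ be differentiable and bounded below, and let $L_0,L_1>0$ be such that for all $w,w'\in\mathbb{R}^d$ with $\|w-w'\|\le\frac1{L_1}$, $$\|\nabla f(w)-\nabla f(w')\|\le\bigl(L_1\|\nabla f(w)\|+L_0\bigr)\|w-w'\|.$$ Let $(w_t)_{t\ge1}$ be generated by AdaGrad-Norm (see context) with learning rate $\eta$, initial point $w_1\in\mathbb{R}^d$ and initial conditioner $\nu_0>0$, where the stochastic gradients satisfy, for all $t\ge1$, $\mathbb{E}[g_t\mid\mathcal{F}_t]=\nabla f(w_t)$ and $\mathbb{E}[\|g_t\|^2\mid\mathcal{F}_t]\le D_0+D_1\|\nabla f(w_t)\|^2$ for constants $D_0\ge0$, $D_1>0$. If $$0<\eta<\frac1{L_1}\min\Bigl\{\frac1{64D_1},\frac1{8\sqrt{D_1}}\Bigr\},$$ then there is a constant $C$, independent of $T$ and $\delta$, such that for every integer $T\ge1$ and every $\delta\in(0,1)$, with probability at least $1-\delta$, $$\min_{1\le t\le T}\|\nabla f(w_t)\|^2\le C\,\frac{1+\ln(1+\sqrt{D_0T})}{T\delta^2}+C\,\frac{\sqrt{D_0}\,\bigl(1+\ln(1+\sqrt{D_0T})\bigr)}{\sqrt{T}\,\delta^2}.$$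
   Context: AdaGrad-Norm: given an objective $f:\mathbb{R}^d\to\mathbb{R}$, a learning rate $\eta>0$, a (deterministic) initial point $w_1\in\mathbb{R}^d$ and a (deterministic) initial conditioner $\nu_0\in(0,\infty)$, for $t=1,2,\dots$ one obtains a random vector (stochastic gradient) $g_t\in\mathbb{R}^d$ and sets $$\nu_t=\nu_{t-1}+\|g_t\|^2,\qquad w_{t+1}=w_t-\eta\,\frac{g_t}{\sqrt{\nu_t}}.$$ $\mathcal{F}_t:=\sigma(g_1,\dots,g_{t-1})$ is the sigma-field generated by the stochastic gradients up to time $t-1$. $\|\cdot\|$ is the Euclidean norm. *)

(* Defs.v *)
From HB Require Import structures.
From mathcomp Require Import all_boot all_order all_algebra.
From mathcomp Require Import all_classical all_reals all_analysis.

Set Implicit Arguments.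
Unset Strict Implicit.
Unset Printing Implicit Defensive.

Import Order.TTheory GRing.Theory Num.Theory.
Import numFieldNormedType.Exports.

Local Open Scope classical_set_scope.
Local Open Scope ring_scope.

(* The library norm `|v| on 'rV[R]_n is the sup norm; it only serves to give
   the topology used by [differentiable]. *)
Definition enorm (R : realType) (n : nat) (v : 'rV[R]_n) : R :=
  Num.sqrt (\sum_(i < n) v ord0 i ^+ 2).

Definition grad (R : realType) (n : nat) (f : 'rV[R]_n -> R) (w : 'rV[R]_n) :
    'rV[R]_n :=
  \row_(i < n) 'D_(delta_mx ord0 i) f w.

(* 'rV[R]_n carries no measurable structure in the library: its Borel
   sigma-algebra is the one generated by the coordinates. *)
Definition random_vector (d : measure_display) (Omega : measurableType d)
    (R : realType) (n : nat) (X : Omega -> 'rV[R]_n) : Prop :=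
  forall i : 'I_n, measurable_fun [set: Omega] (fun x => X x ord0 i).

(* F_t = sigma(g_1, ..., g_(t-1)); in particular F_1 is trivial. The value
   g 0 is never used. *)
Definition grad_filtration (d : measure_display) (Omega : measurableType d)
    (R : realType) (n : nat) (g : nat -> Omega -> 'rV[R]_n) (t : nat) :
    set (set Omega) :=
  <<s \bigcup_(s in [set s | (1 <= s < t)%N]) \bigcup_(i in [set: 'I_n])
        preimage_set_system [set: Omega] (fun x => g s x ord0 i) measurable >>.

(* Y is a version of E[X | F]; F is meant to be a sub-sigma-algebra of the
   measurable sets of Omega. *)
Record is_cond_exp (d : measure_display) (Omega : measurableType d)
    (R : realType) (P : probability Omega R) (F : set (set Omega))
    (X Y : Omega -> R) : Prop := IsCondExp {
  cond_exp_integrableX : P.-integrable [set: Omega] (EFin \o X) ;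
  cond_exp_integrable : P.-integrable [set: Omega] (EFin \o Y) ;
  cond_exp_measurable :
    forall B : set R, measurable B -> F (Y @^-1` B) ;
  cond_exp_integral : forall A : set Omega, F A ->
    (\int[P]_(x in A) (Y x)%:E = \int[P]_(x in A) (X x)%:E)%E }.

(* Times start at 1 for w and g, and at 0 for nu; w 0 and g 0 are
   unconstrained and unused. *)
Record adagrad_norm (Omega : Type) (R : realType) (n : nat) (eta : R)
    (w1 : 'rV[R]_n) (nu0 : R) (g : nat -> Omega -> 'rV[R]_n)
    (nu : nat -> Omega -> R) (w : nat -> Omega -> 'rV[R]_n) : Prop :=
  AdaGradNorm {
  adagrad_nu0 : forall x, nu 0 x = nu0 ;
  adagrad_nu : forall t x, (1 <= t)%N ->
    nu t x = nu t.-1 x + enorm (g t x) ^+ 2 ;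
  adagrad_w1 : forall x, w 1 x = w1 ;
  adagrad_w : forall t x, (1 <= t)%N ->
    w t.+1 x = w t x - (eta / Num.sqrt (nu t x)) *: g t x }.

(* The default value of the big operator is the t = 1 term, so for T >= 1 this
   is exactly min_(1 <= t <= T) ||grad f (w t)||^2. *)
Definition min_sq_grad (R : realType) (n : nat) (f : 'rV[R]_n -> R)
    (w : nat -> 'rV[R]_n) (T : nat) : R :=
  \big[Num.min/enorm (grad f (w 1)) ^+ 2]_(1 <= t < T.+1)
    enorm (grad f (w t)) ^+ 2.

(* Main.v *)
(* Write G_t = ||grad f(w_t)||, s_t = sqrt(nu_t), V_t = D0 + D1 G_t^2 and
   X = sum_(t <= T) G_t^2 / s_(t-1).  Local smoothness gives a descent inequality
   in which 1 / s_t is replaced by the predictable 1 / s_(t-1).  The error is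
   G_t (s_t / s_(t-1) - 1), which Young's inequality splits into
   ||g_t||^2 G_t^2 / (4 V_t s_(t-1)), of expectation at most E[X] / 4 after
   summation, and V_t (1 / s_(t-1) - 1 / s_t), which telescopes up to differences
   G_(t+1)^2 - G_t^2; smoothness makes these small against X because eta L1 D1 is
   small.  Hence E[X] <= C + C E[ln s_T].  Conversely, testing the variance bound
   against 1 / sqrt(nu_(t-1) + D0 T) gives
   E[s_T] <= s_0 + 2 sqrt(D0 T) + D1 E[X].  Together, E[s_T] = O(1 + sqrt(D0 T))
   and E[X] = O(1 + ln(1 + sqrt(D0 T))), and since T min_t G_t^2 <= s_T X, Markov's
   inequality for (s_T / A + X / B) / 2 concludes. *)
Require Import Defs.
From HB Require Import structures.
From mathcomp Require Import all_boot all_order all_algebra.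
From mathcomp Require Import all_classical all_reals all_analysis.
From mathcomp Require Import measurable_realfun ring lra.

Set Implicit Arguments.
Unset Strict Implicit.
Unset Printing Implicit Defensive.

Import Order.TTheory GRing.Theory Num.Theory.
Import numFieldNormedType.Exports.

Local Open Scope classical_set_scope.
Local Open Scope ring_scope.

(** [E[X]] and [E[s_T]] bound each other, and the circle is broken by keeping the logarithm as a
    family of tangent lines: [ln s_T] is replaced by an affine function of [s_T] with a free contact
    point [c]. Expectations then pass through without Jensen's inequality, and a large [c] makes the
    slope in [E[s_T]] as small as needed. The terms in [E[X]] on the right can be absorbed because
    33/32 (1/4 + 1/16) < 1/2; the smallness 1/64 enters the 33/32 and the 1/16, while the 1/4 is the
    Young weight. The values f(w_t) are telescoped on each trajectory, before any integration, so
    only f(w_1) and the lower bound survive and the integrability of f(w_t) never arises.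
    Integrability of the remaining terms comes from the normalised steps: each has length at most
    [eta], so w_t stays in a deterministic ball and its gradient is bounded for each fixed t. All
    weights tested against the noise are therefore bounded, and the pull-out property of conditional
    expectations is needed for bounded functions only. *)

(** * Euclidean norm and local smoothness *)

Definition dotv (R : realType) (n : nat) (u v : 'rV[R]_n) : R :=
  \sum_(i < n) u ord0 i * v ord0 i.

Section EuclideanNorm.
Variables (R : realType) (n : nat).
Implicit Types u v w : 'rV[R]_n.

Lemma enorm_ge0 u : 0 <= enorm u.
Proof. exact: sqrtr_ge0. Qed.

Lemma sqr_enorm u : enorm u ^+ 2 = \sum_(i < n) u ord0 i ^+ 2.
Proof. by rewrite sqr_sqrtr// sumr_ge0// => i _; rewrite sqr_ge0. Qed.

Lemma enormZ c u : enorm (c *: u) = `|c| * enorm u.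
Proof.
rewrite /enorm -sqrtr_sqr -sqrtrM ?sqr_ge0//; congr Num.sqrt.
by rewrite mulr_sumr; apply: eq_bigr => i _; rewrite mxE exprMn.
Qed.

Lemma enormN u : enorm (- u) = enorm u.
Proof. by rewrite -scaleN1r enormZ normrN1 mul1r. Qed.

Lemma enormB u v : enorm (u - v) = enorm (v - u).
Proof. by rewrite -enormN opprB. Qed.

Lemma enorm0 : enorm (0 : 'rV[R]_n) = 0.
Proof. by rewrite -(scale0r 0) enormZ normr0 mul0r. Qed.

Lemma abs_coord_le_enorm u i : `|u ord0 i| <= enorm u.
Proof.
rewrite -sqrtr_sqr ler_wsqrtr// (bigD1 i)//= lerDl.
by rewrite sumr_ge0// => j _; rewrite sqr_ge0.
Qed.

Lemma dotvZr c u v : dotv u (c *: v) = c * dotv u v.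
Proof.
by rewrite /dotv mulr_sumr; apply: eq_bigr => i _; rewrite mxE mulrCA.
Qed.

Lemma dotvBl u v w : dotv (u - v) w = dotv u w - dotv v w.
Proof.
by rewrite /dotv -sumrB; apply: eq_bigr => i _; rewrite !mxE mulrBl.
Qed.

(** The sum of the squares of the coordinates of [enorm v *: u - enorm u *: v] is a multiple of the
    gap in the inequality, by a factor that is positive once the two zero cases are set aside. *)
Lemma dotv_le_enorm u v : dotv u v <= enorm u * enorm v.
Proof.
have z0 (x y : 'rV[R]_n) : enorm x = 0 -> dotv x y = 0.
  move=> x0; apply: big1 => i _; have := abs_coord_le_enorm x i.
  by rewrite x0 normr_le0 => /eqP->; rewrite mul0r.
have [/z0 ->|u0] := eqVneq (enorm u) 0; first by rewrite mulr_ge0 ?enorm_ge0.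
have [v0|v0] := eqVneq (enorm v) 0.
  have -> : dotv u v = dotv v u by apply: eq_bigr => i _; rewrite mulrC.
  by rewrite v0 mulr0 z0.
have ab0 : 0 < enorm u * enorm v by rewrite mulr_gt0 ?lt0r ?u0 ?v0 ?enorm_ge0.
have : 0 <= \sum_(i < n) (enorm v * u ord0 i - enorm u * v ord0 i) ^+ 2.
  by rewrite sumr_ge0// => i _; rewrite sqr_ge0.
have -> : \sum_(i < n) (enorm v * u ord0 i - enorm u * v ord0 i) ^+ 2 =
    2 * (enorm u * enorm v) * (enorm u * enorm v - dotv u v).
  transitivity (enorm v ^+ 2 * enorm u ^+ 2 + enorm u ^+ 2 * enorm v ^+ 2
      - 2 * (enorm u * enorm v) * dotv u v); last by ring.
  rewrite [X in _ = _ * X + _ - _]sqr_enorm [X in _ = _ + _ * X - _]sqr_enorm.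
  rewrite /dotv !mulr_sumr -big_split/= -sumrB.
  by apply: eq_bigr => i _; ring.
by rewrite -mulrA pmulr_rge0// pmulr_rge0// subr_ge0.
Qed.

Lemma ler_enormD u v : enorm (u + v) <= enorm u + enorm v.
Proof.
rewrite -ler_sqr ?nnegrE ?addr_ge0 ?enorm_ge0// sqrrD sqr_enorm.
have -> : \sum_(i < n) (u + v) ord0 i ^+ 2 =
    enorm u ^+ 2 + 2 * dotv u v + enorm v ^+ 2.
  rewrite !sqr_enorm /dotv mulr_sumr -!big_split/=.
  by apply: eq_bigr => i _; rewrite mxE; ring.
by have := dotv_le_enorm u v; lra.
Qed.

End EuclideanNorm.

(** * Descent inequality from a Lipschitz bound centred at one point *)

Section Descent.
Variables (R : realType) (n : nat) (f : 'rV[R]_n -> R).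
Hypothesis f_diff : forall u, differentiable f u.
Implicit Types u v : 'rV[R]_n.

Lemma diff_dotv_grad u v : 'd f u v = dotv (grad f u) v.
Proof.
rewrite [X in 'd f u X](row_sum_delta v) linear_sum/=; apply: eq_bigr => i _.
by rewrite linearZ/= /grad mxE deriveE// mulrC.
Qed.

Lemma mean_value_grad u v : exists2 c : R, 0 <= c <= 1 &
  f v - f u = dotv (grad f (u + c *: (v - u))) (v - u).
Proof.
pose l (s : R) : 'rV[R]_n := u + s *: (v - u).
have dl s : is_diff s l (fun h => h *: (v - u)).
  rewrite -[fun h => _](add0r (fun h : R => h *: (v - u))).
  by rewrite /l; apply: is_diffD.
have dfl (s : R) : is_derive s (1 : R) (f \o l : R -> R) (dotv (grad f (l s)) (v - u)).
  have dfls : differentiable (f \o l) s by apply: differentiable_comp.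
  apply: DeriveDef; first exact/derivable1_diffP.
  rewrite deriveE// diff_comp//= diff_val scale1r.
  exact: diff_dotv_grad.
have [c c01] := MVT_segment ler01 (fun s _ => dfl s)
  (derivable_within_continuous (fun s _ => @ex_derive _ _ _ _ _ _ _ (dfl s))).
rewrite subr0 mulr1 /= /l scale1r scale0r addr0 [u + (v - u)]addrC subrK => e.
by exists c => //; move: c01; rewrite in_itv.
Qed.

(** The mean value theorem evaluates the gradient at one unknown point of the segment, hence the
    coefficient [K] where the integral form of the remainder would give [K / 2]. *)
Lemma descent u v (K : R) :
  (forall x, enorm (x - u) <= enorm (v - u) ->
     enorm (grad f x - grad f u) <= K * enorm (x - u)) ->
  f v <= f u + dotv (grad f u) (v - u) + K * enorm (v - u) ^+ 2.
Proof.
move=> lip; have [c /andP[c0 c1] e] := mean_value_grad u v.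
set x := u + _ in e.
have xu : enorm (x - u) = c * enorm (v - u).
  by rewrite /x addrC addKr enormZ ger0_norm.
have xule : enorm (x - u) <= enorm (v - u).
  by rewrite xu ler_piMl ?enorm_ge0.
have gx := lip _ xule.
(* When [v = u] the hypothesis [lip] says nothing about the sign of [K]. *)
have K0 : enorm (v - u) = 0 \/ 0 <= K.
  have [->|vu] := eqVneq (enorm (v - u)) 0; first by left.
  right; have := le_trans (enorm_ge0 _) (lip v (lexx _)).
  by rewrite pmulr_lge0// lt0r vu enorm_ge0.
have : dotv (grad f x - grad f u) (v - u) <= K * enorm (v - u) ^+ 2.
  apply: le_trans (dotv_le_enorm _ _) _.
  rewrite expr2 mulrA ler_wpM2r ?enorm_ge0// (le_trans gx)//.
  by case: K0 => [v0|K0]; rewrite ?xu ?v0 ?mulr0// -xu ler_wpM2l.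
rewrite dotvBl; lra.
Qed.

End Descent.

Section LocalSmoothness.
Variables (R : realType) (n : nat) (f : 'rV[R]_n -> R) (L0 L1 : R).
Hypotheses (L0_gt0 : 0 < L0) (L1_gt0 : 0 < L1).
Hypothesis f_smooth : forall u v : 'rV[R]_n, enorm (u - v) <= 1 / L1 ->
  enorm (grad f u - grad f v) <=
    (L1 * enorm (grad f u) + L0) * enorm (u - v).

(* Chaining m steps of length at most 1 / L1 at most doubles the local
   Lipschitz constant L1 * enorm (grad f u) + L0 at each step. *)
Lemma smooth_chain m (u v : 'rV[R]_n) : enorm (u - v) <= m%:R / L1 ->
  enorm (grad f u - grad f v) <=
    2 ^+ m * (L1 * enorm (grad f u) + L0) * enorm (u - v).
Proof.
pose h x := L1 * enorm (grad f x) + L0.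
have h0 x : 0 <= h x by rewrite addr_ge0 ?mulr_ge0 ?enorm_ge0 ?ltW.
have hstep x y : enorm (x - y) <= 1 / L1 -> h y <= 2 * h x.
  move=> xy; have gxy := f_smooth xy.
  have L1xy : L1 * enorm (x - y) <= 1 by rewrite mulrC -ler_pdivlMr.
  have : h y <= h x + L1 * enorm (grad f x - grad f y).
    have := ler_enormD (grad f x) (grad f y - grad f x).
    rewrite addrC subrK enormB => gy; rewrite /h addrAC lerD2r -mulrDr.
    by rewrite ler_wpM2l// ltW.
  have : L1 * enorm (grad f x - grad f y) <= h x.
    apply: le_trans (ler_wpM2l (ltW L1_gt0) gxy) _.
    by rewrite -/(h x) mulrCA ler_piMr.
  lra.
(* The growth of [h] has to be carried along: the last step of the chain has Lipschitz constant
   [h x] at its starting point [x]. *)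
suff : enorm (u - v) <= m%:R / L1 -> h v <= 2 ^+ m * h u /\
   enorm (grad f u - grad f v) <= 2 ^+ m * h u * enorm (u - v).
  by move=> H /H[].
elim: m v => [|m IH] v uv.
  have : enorm (u - v) = 0.
    by apply/eqP; rewrite eq_le enorm_ge0 andbT (le_trans uv)// mul0r.
  move=> uv0; have gle : enorm (u - v) <= 1 / L1 by rewrite uv0 divr_ge0// ltW.
  have uve : u = v.
    apply/eqP; rewrite -subr_eq0; apply/eqP/rowP => i; rewrite [RHS]mxE /=.
    by have := abs_coord_le_enorm (u - v) i; rewrite uv0 normr_le0 => /eqP.
  by rewrite uve !subrr enorm0 mulr0 expr0 mul1r; split.
(* The intermediate point [x] lies a fraction m / (m + 1) of the way from [u] to [v], which leaves a
   last step of length at most [1 / L1]. *)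
pose c : R := m%:R / m.+1%:R.
have m0 : (m.+1%:R : R) != 0 by rewrite pnatr_eq0.
have mp : 0 < (m.+1%:R : R) by rewrite ltr0n.
have c0 : 0 <= c by rewrite divr_ge0.
have c1 : 1 - c = m.+1%:R^-1.
  by rewrite /c -{1}(divff m0) -mulrBl -natrB// subSnn div1r.
pose x := u + c *: (v - u).
have ux : enorm (u - x) = c * enorm (u - v).
  by rewrite /x opprD addrA subrr add0r enormN enormZ ger0_norm// enormB.
have xv : enorm (x - v) = (1 - c) * enorm (u - v).
  rewrite (_ : x - v = (1 - c) *: (u - v)).
    by rewrite enormZ ger0_norm// c1 invr_ge0.
  by apply/rowP => i; rewrite /x !mxE; ring.
have uxm : enorm (u - x) <= m%:R / L1.
  rewrite ux /c mulrAC ler_pdivrMr// -mulrA ler_wpM2l//.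
  by rewrite mulrC.
have xv1 : enorm (x - v) <= 1 / L1.
  by rewrite xv c1 mulrC ler_pdivrMr// mulrAC mul1r.
have [hx gx] := IH _ uxm.
split; first by rewrite exprS -mulrA (le_trans (hstep _ _ xv1))// ler_wpM2l.
have gxv := f_smooth xv1; rewrite -/(h x) in gxv.
have : enorm (grad f u - grad f v) <= 2 ^+ m * h u * enorm (u - v).
  have -> : grad f u - grad f v = (grad f u - grad f x) + (grad f x - grad f v).
    by rewrite addrA subrK.
  apply: le_trans (ler_enormD _ _) _.
  apply: le_trans (lerD gx gxv) _.
  rewrite (_ : _ * enorm (u - v) =
    2 ^+ m * h u * enorm (u - x) + 2 ^+ m * h u * enorm (x - v)).
    by rewrite lerD2l ler_wpM2r// enorm_ge0.
  by rewrite ux xv; ring.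
move/le_trans; apply; rewrite exprS ler_wpM2r ?enorm_ge0// ler_wpM2r//.
by rewrite ler_peMl ?exprn_ge0// ler1n.
Qed.

End LocalSmoothness.

(** * Deterministic trajectories *)

(** Concavity of [ln]: the right-hand side is the tangent at [c]. *)
Lemma ln_le_tangent (R : realType) (c x : R) : 0 < c -> 0 < x ->
  ln x <= ln c + x / c - 1.
Proof.
move=> c0 x0; have xc0 : 0 < x / c by rewrite divr_gt0.
have -> : ln x = ln c + ln (x / c) by rewrite ln_div ?posrE// addrC subrK.
rewrite -addrA lerD2l; have := @le_ln1Dx R (x / c - 1).
by rewrite [1 + _]addrC subrK; apply; rewrite ltrBrDl subrr.
Qed.

(** * Estimates on a single trajectory, reduced to real sequences *)

Section Trajectory.
Variables (R : realType) (eta a b D0 D1 m : R).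
Variables (F G p u nu : nat -> R).
Hypotheses (eta_gt0 : 0 < eta) (a_ge0 : 0 <= a) (b_ge0 : 0 <= b).
Hypotheses (D0_ge0 : 0 <= D0) (D1_gt0 : 0 < D1).
Hypotheses (a_eta : a * eta <= 1 / 64) (a_eta_D1 : D1 * (a * eta) <= 1 / 64).
Hypotheses (nu0_gt0 : 0 < nu 0%N).
Hypothesis nuS : forall t, nu t.+1 = nu t + u t.+1 ^+ 2.
Hypotheses (u_ge0 : forall t, 0 <= u t) (G_ge0 : forall t, 0 <= G t).
Hypothesis p_le : forall t, p t.+1 <= G t.+1 * u t.+1.
Hypothesis F_ge : forall t, m <= F t.

(** In the application [F], [G], [p] and [u] are f(w_t), the gradient norm, the inner product of
    gradient and stochastic gradient, and the norm of the latter. They start at time 1 and [nu] at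
    time 0, so the predictable weight at time [t.+1] is the inverse of [s t]. *)
Let s t := Num.sqrt (nu t).

Hypothesis F_descent : forall t, F t.+2 <= F t.+1 - eta * p t.+1 / s t.+1 +
  (a * G t.+1 + b) * (eta * u t.+1 / s t.+1) ^+ 2.
Hypothesis G_lip : forall t,
  G t.+2 - G t.+1 <= (a * G t.+2 + b) * (eta * u t.+1 / s t.+1).

Lemma nu_gt0 t : 0 < nu t.
Proof. by elim: t => // t IH; rewrite nuS ltr_pwDl// sqr_ge0. Qed.

Let s_gt0 t : 0 < s t.
Proof. by rewrite sqrtr_gt0 nu_gt0. Qed.

Let s_le t : s t <= s t.+1.
Proof. by rewrite ler_wsqrtr// nuS lerDl sqr_ge0. Qed.

Let sqr_s t : s t ^+ 2 = nu t.
Proof. by rewrite sqr_sqrtr// ltW// nu_gt0. Qed.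

Let u2E t : u t.+1 ^+ 2 = s t.+1 ^+ 2 - s t ^+ 2.
Proof. by rewrite !sqr_s nuS; ring. Qed.

Let u_le_s t : u t.+1 <= s t.+1.
Proof.
by rewrite -ler_sqr ?nnegrE ?u_ge0 ?(ltW (s_gt0 _))// u2E gerDl oppr_le0 sqr_ge0.
Qed.

Lemma s_start_le t : s 0 <= s t.
Proof. by elim: t => // t IH; apply: le_trans IH (s_le t). Qed.

(** Each ratio is [1 - nu T / nu T.+1], at most an increment of [ln nu]: this is the tangent at
    [nu T.+1] evaluated at [nu T]. *)
Lemma sum_ratio_le_ln T :
  \sum_(i < T) u i.+1 ^+ 2 / nu i.+1 <= ln (nu T) - ln (nu 0%N).
Proof.
elim: T => [|T IH]; first by rewrite big_ord0 subrr.
rewrite big_ord_recr/=; have n1 := nu_gt0 T.+1; have n0 := nu_gt0 T.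
suff : u T.+1 ^+ 2 / nu T.+1 <= ln (nu T.+1) - ln (nu T) by lra.
have := ln_le_tangent n1 n0.
have -> : u T.+1 ^+ 2 = nu T.+1 - nu T by rewrite nuS; ring.
by rewrite mulrBl divff ?gt_eqF//; lra.
Qed.

(** The factor 2 comes from [nu = s ^+ 2]; the tangent at [c] is applied to [s T / s 0], which makes
    the bound affine in [s T]. *)
Lemma sum_ratio_le (c : R) T : 0 < c ->
  \sum_(i < T) u i.+1 ^+ 2 / nu i.+1 <= 2 * (ln c + s T / (s 0 * c) - 1).
Proof.
move=> c0; apply: le_trans (sum_ratio_le_ln T) _.
rewrite -!sqr_s !lnXn// -mulrnBl -[leLHS]mulr_natl ler_wpM2l//.
rewrite -ln_div ?posrE// invfM mulrA.
by rewrite ln_le_tangent// divr_gt0.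
Qed.

Let V t := D0 + D1 * G t ^+ 2.

Let V_ge0 t : 0 <= V t.
Proof. by rewrite addr_ge0// mulr_ge0 ?sqr_ge0// ltW. Qed.

Let G0_V t : V t = 0 -> G t = 0.
Proof.
rewrite /V => /eqP; rewrite paddr_eq0 ?mulr_ge0 ?sqr_ge0 ?(ltW D1_gt0)//.
by rewrite mulf_eq0 (gt_eqF D1_gt0)/= sqrf_eq0 => /andP[_ /eqP].
Qed.

(* AM-GM: G <= (x + y) G^2 / (4 V) + V / (x + y) for x = s_t and y = s_(t+1). *)
Let young t : G t.+1 * (s t.+1 / s t - 1) <=
  1 / 4 * (u t.+1 ^+ 2 * (G t.+1 ^+ 2 / V t.+1 / s t)) +
  V t.+1 * ((s t)^-1 - (s t.+1)^-1).
Proof.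
have x0 := s_gt0 t; have y0 := s_gt0 t.+1; have xy := s_le t.
have V0 := V_ge0 t.+1; have GV := @G0_V t.+1; have g0 := G_ge0 t.+1.
rewrite u2E; move: (s t) (s t.+1) (G t.+1) (V t.+1) x0 y0 xy V0 GV g0
  => x y g v x0 y0 xy v0 gv g0.
have [v00|vn0] := eqVneq v 0; first by rewrite v00 gv//; lra.
have {v0 gv}v0 : 0 < v by rewrite lt0r vn0.
have xyx0 : 0 <= (y - x) / x by rewrite divr_ge0 ?subr_ge0// ltW.
have S0 : 0 < x + y by lra.
have -> : y / x - 1 = (y - x) / x by field; rewrite gt_eqF.
have h1 : v / (x + y) * ((y - x) / x) <= v * (x^-1 - y^-1).
  have -> : x^-1 - y^-1 = y^-1 * ((y - x) / x).
    by field; rewrite !gt_eqF.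
  rewrite [leRHS]mulrA ler_wpM2r// ler_wpM2l ?(ltW v0)// lef_pV2 ?posrE//; lra.
have h2 : g <= (x + y) * g ^+ 2 / (4 * v) + v / (x + y).
  rewrite -subr_ge0.
  have -> : (x + y) * g ^+ 2 / (4 * v) + v / (x + y) - g =
     ((x + y) * g - 2 * v) ^+ 2 / (4 * v * (x + y)).
    by field; rewrite !gt_eqF.
  by rewrite divr_ge0 ?sqr_ge0// ltW// !mulr_gt0.
have h3 := ler_wpM2r xyx0 h2.
have e : 1 / 4 * ((y ^+ 2 - x ^+ 2) * (g ^+ 2 / v / x)) =
  (x + y) * g ^+ 2 / (4 * v) * ((y - x) / x).
  by field; rewrite !gt_eqF.
by rewrite e; apply: le_trans h3 _; rewrite mulrDl lerD2l.
Qed.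

(** Passing from [s t.+1] to [s t] costs [p (1 / s t - 1 / s t.+1)]. Both this cost and the
    quadratic term weighted by [a] are bounded by multiples of the left-hand side of [young]. *)
Let step t : eta * p t.+1 / s t <= F t.+1 - F t.+2 +
  b * eta ^+ 2 * (u t.+1 ^+ 2 / nu t.+1) +
  eta * (33 / 32) * (1 / 4 * (u t.+1 ^+ 2 * (G t.+1 ^+ 2 / V t.+1 / s t)) +
  V t.+1 * ((s t)^-1 - (s t.+1)^-1)).
Proof.
have x0 := s_gt0 t; have y0 := s_gt0 t.+1; have xy := s_le t.
have Fd := F_descent t; have pG := p_le t; have uy := u_le_s t.
have g0 := G_ge0 t.+1; have u0 := u_ge0 t.+1; have u2 := u2E t.
have := ler_wpM2l (_ : 0 <= eta * (33 / 32)) (young t).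
move=> /(_ (mulr_ge0 (ltW eta_gt0) _)) Y.
apply: le_trans (lerD (lexx _) (Y _)); last by lra.
rewrite -sqr_s.
move: (s t) (s t.+1) (G t.+1) (u t.+1) (p t.+1) x0 y0 xy Fd pG uy g0 u0 u2
  => x y g v q x0 y0 xy Fd pG uy g0 u0 u2 {Y}.
have q1 : 0 <= y / x - 1 by rewrite subr_ge0 ler_pdivlMr// mul1r.
have -> : eta * q / x = eta * q / y + eta * (q * (x^-1 - y^-1)) by ring.
(* The inner product [q] may be negative, but its weight is not, so the upper bound [pG] is
   enough. *)
have h1 : q * (x^-1 - y^-1) <= g * (y / x - 1).
  have d0 : 0 <= x^-1 - y^-1 by rewrite subr_ge0 lef_pV2 ?posrE.
  apply: le_trans (ler_wpM2r d0 pG) _; rewrite -mulrA ler_wpM2l//.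
  apply: le_trans (ler_wpM2r d0 uy) _.
  by rewrite mulrBr divff ?gt_eqF.
(* With r = x / y <= 1 this reads 1 - r^2 <= 2 (1 / r - 1). *)
have h2 : (v / y) ^+ 2 <= 2 * (y / x - 1).
  rewrite expr_div_n u2 mulrBl divff ?expf_neq0 ?gt_eqF//.
  rewrite -subr_ge0.
  have -> : 2 * (y / x - 1) - (1 - x ^+ 2 / y ^+ 2) =
     (y - x) * (2 * y ^+ 2 - x * y - x ^+ 2) / (x * y ^+ 2).
    by field; rewrite !gt_eqF.
  have A1 := ler_pM (ltW x0) (ltW x0) xy xy.
  have A2 := ler_wpM2r (ltW y0) xy.
  have A3 : 0 <= 2 * y ^+ 2 - x * y - x ^+ 2 by rewrite !expr2; lra.
  have A4 : 0 <= y - x by rewrite subr_ge0.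
  by rewrite divr_ge0 ?(mulr_ge0 A4 A3)// mulr_ge0 ?sqr_ge0// ltW.
have h3 := ler_wpM2l (ltW eta_gt0) h1.
have aeta0 : 0 <= a * eta by rewrite mulr_ge0// ltW.
have h4 : a * g * (eta * v / y) ^+ 2 <= eta * (1 / 32) * (g * (y / x - 1)).
  have -> : a * g * (eta * v / y) ^+ 2 = eta * (g * (a * eta * (v / y) ^+ 2)).
    by ring.
  have -> : eta * (1 / 32) * (g * (y / x - 1)) =
     eta * (g * (1 / 64 * (2 * (y / x - 1)))).
    by field; rewrite gt_eqF.
  rewrite ler_wpM2l ?(ltW eta_gt0)// ler_wpM2l//.
  by apply: ler_pM a_eta h2 => //; exact: sqr_ge0.
have e5 : (a * g + b) * (eta * v / y) ^+ 2 =
  a * g * (eta * v / y) ^+ 2 + b * eta ^+ 2 * (v ^+ 2 / y ^+ 2).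
  by rewrite -expr_div_n; ring.
rewrite e5 in Fd; lra.
Qed.

(* Weight of the AM-GM splitting in G_step; it makes D1 k <= 1 / 32 and k <= 1. *)
Let k := 1 / (32 * (D1 + 1)).
Let theta := 2 * (a * eta) + k.

Let k_gt0 : 0 < k.
Proof. by rewrite divr_gt0// mulr_gt0// addr_gt0. Qed.

Let k_le : k <= 1 / 32.
Proof.
rewrite ler_pdivrMr ?mulr_gt0 ?addr_gt0//.
by have := D1_gt0; lra.
Qed.

Let D1k_le : D1 * k <= 1 / 32.
Proof.
rewrite /k mulrA mulr1 ler_pdivrMr ?mulr_gt0 ?addr_gt0//; lra.
Qed.

(** From g^2 - h^2 <= 2 g (g - h) and [G_lip]. The [a] part only uses that the normalised step is at
    most 1 and goes into [theta]. The [b] part is split with weight [k], which leaves the squared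
    step, summable by [sum_ratio_le_ln]. *)
Let G_step t :
  (1 - theta) * G t.+2 ^+ 2 <=
  G t.+1 ^+ 2 + b ^+ 2 * eta ^+ 2 / k * (u t.+1 ^+ 2 / nu t.+1).
Proof.
have y0 := s_gt0 t.+1; have lip := G_lip t; have g0 := G_ge0 t.+2.
have u0 := u_ge0 t.+1; have uy := u_le_s t; have h0 := G_ge0 t.+1.
rewrite -sqr_s /theta.
have k0 := k_gt0.
move: (s t.+1) (G t.+1) (G t.+2) (u t.+1) y0 lip g0 u0 uy h0
  => y h g v y0 lip g0 u0 uy h0.
rewrite -expr_div_n; set r := v / y.
have r0 : 0 <= r by rewrite divr_ge0// ltW.
have r1 : r <= 1 by rewrite ler_pdivrMr// mul1r.
have {lip} lip : g - h <= (a * g + b) * (eta * r) by rewrite /r (mulrA eta).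
have e1 : g ^+ 2 - h ^+ 2 <= 2 * g * (g - h).
  by rewrite -subr_ge0 (_ : _ - _ = (g - h) ^+ 2) ?sqr_ge0//; ring.
have e2 : 2 * g * (g - h) <= 2 * g * ((a * g + b) * (eta * r)).
  by rewrite ler_wpM2l// mulr_ge0.
have e3 : 2 * (a * eta * g ^+ 2) * r <= 2 * (a * eta * g ^+ 2).
  by rewrite ler_piMr// !mulr_ge0 ?sqr_ge0// ltW.
have e4 : 2 * g * (b * eta * r) <= k * g ^+ 2 + b ^+ 2 * eta ^+ 2 / k * r ^+ 2.
  rewrite -subr_ge0 (_ : _ - _ = (k * g - b * eta * r) ^+ 2 / k).
    by rewrite divr_ge0 ?sqr_ge0// ltW.
  by field; rewrite gt_eqF.
have e5 : 2 * g * ((a * g + b) * (eta * r)) =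
  2 * (a * eta * g ^+ 2) * r + 2 * g * (b * eta * r) by ring.
rewrite e5 in e2.
have -> : (1 - (2 * (a * eta) + k)) * g ^+ 2 =
  g ^+ 2 - 2 * (a * eta * g ^+ 2) - k * g ^+ 2 by ring.
lra.
Qed.

(** The boundary term carries the factor [1 - theta] because [G_step], divided by [s T.+1], then
    bounds the next boundary term by the [G T.+1 ^+ 2 / s T.+1] that the new summand subtracts. *)
Let abel T : \sum_(i < T) G i.+1 ^+ 2 * ((s i)^-1 - (s i.+1)^-1) <=
  G 1 ^+ 2 / s 0 - (1 - theta) * G T.+1 ^+ 2 / s T +
  \sum_(i < T) (theta * (G i.+1 ^+ 2 / s i) +
    b ^+ 2 * eta ^+ 2 / k / s 0 * (u i.+1 ^+ 2 / nu i.+1)).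
Proof.
have th0 : 0 <= theta.
  by rewrite /theta addr_ge0 ?(ltW k_gt0)// !mulr_ge0// ltW.
elim: T => [|T IH].
  rewrite !big_ord0 addr0 mulrBl mul1r mulrBl opprB addrC subrK.
  by rewrite mulr_ge0 ?invr_ge0 ?mulr_ge0 ?sqr_ge0// ltW.
rewrite !big_ord_recr/=.
have gs : (1 - theta) * G T.+2 ^+ 2 / s T.+1 <= G T.+1 ^+ 2 / s T.+1 +
   b ^+ 2 * eta ^+ 2 / k / s 0 * (u T.+1 ^+ 2 / nu T.+1).
  apply: le_trans (ler_wpM2r _ (G_step T)) _; first by rewrite invr_ge0 ltW.
  rewrite mulrDl lerD2l mulrAC ler_wpM2r//.
    by rewrite divr_ge0 ?sqr_ge0// ltW// nu_gt0.
  rewrite ler_wpM2l ?lef_pV2 ?posrE ?s_gt0 ?s_start_le//.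
  by apply: divr_ge0 (ltW k_gt0); rewrite mulr_ge0 ?sqr_ge0.
have -> : G T.+1 ^+ 2 * ((s T)^-1 - (s T.+1)^-1) =
  G T.+1 ^+ 2 / s T - G T.+1 ^+ 2 / s T.+1 by ring.
move: IH.
have -> : (1 - theta) * G T.+1 ^+ 2 / s T =
  G T.+1 ^+ 2 / s T - theta * (G T.+1 ^+ 2 / s T) by ring.
lra.
Qed.

(* 33 / 32 bounds 1 + 2 a eta and comes from absorbing the term of F_descent
   weighted by a into the Young bound.  The weights D1 G^2 (1/s_t - 1/s_(t+1))
   are summed by parts, which costs only 1 / 16 of the left-hand side. *)
Lemma trajectory_bound (c : R) T : 0 < c ->
  \sum_(i < T) eta * p i.+1 / s i <=
    F 1 - m + eta * (33 / 32) * ((D0 + D1 * G 1 ^+ 2) / s 0) +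
    (b * eta ^+ 2 + eta * (33 / 32) * (D1 * (b ^+ 2 * eta ^+ 2 / k / s 0))) *
      (2 * (ln c + s T / (s 0 * c) - 1)) +
    eta * (33 / 32) *
    (1 / 4 * \sum_(i < T) u i.+1 ^+ 2 * (G i.+1 ^+ 2 / V i.+1 / s i) +
     1 / 16 * \sum_(i < T) G i.+1 ^+ 2 / s i).
Proof.
move=> c0; have Hu := sum_ratio_le T c0; have Hab := abel T.
have [k0 th1] : 0 < k /\ theta <= 1.
  by split; [exact: k_gt0|rewrite /theta; have := k_le; have := a_eta; lra].
(* Each of [2 * D1 * (a * eta)] and [D1 * k] is at most 1 / 32. *)
have D1th : D1 * theta <= 1 / 16.
  rewrite /theta mulrDr mulrCA; have := D1k_le; have := a_eta_D1; lra.
have eta33 : 0 <= eta * (33 / 32) by rewrite mulr_ge0 ?(ltW eta_gt0)//; lra.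
have Hs : \sum_(i < T) eta * p i.+1 / s i <= \sum_(i < T) (F i.+1 - F i.+2 +
  b * eta ^+ 2 * (u i.+1 ^+ 2 / nu i.+1) +
  eta * (33 / 32) * (1 / 4 * (u i.+1 ^+ 2 * (G i.+1 ^+ 2 / V i.+1 / s i)) +
  V i.+1 * ((s i)^-1 - (s i.+1)^-1))).
  by apply: ler_sum => i _; exact: step.
apply: le_trans Hs _.
rewrite big_split/= big_split/=; set SF := \sum_(i < T) (_ - _).
rewrite -!mulr_sumr big_split/= -mulr_sumr.
set W := \sum_(i < T) u i.+1 ^+ 2 * (_ / s _).
set X := \sum_(i < T) G i.+1 ^+ 2 / s i.
set U := \sum_(i < T) u i.+1 ^+ 2 / nu i.+1 in Hu *.
have tele : SF <= F 1 - m.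
  suff -> : SF = F 1 - F T.+1.
    by rewrite lerD2l lerN2.
  rewrite /SF; elim: T {Hu Hab SF W X U} => [|T IH].
    by rewrite big_ord0 subrr.
  by rewrite big_ord_recr/= IH; lra.
have VA : \sum_(i < T) V i.+1 * ((s i)^-1 - (s i.+1)^-1) <=
    (D0 + D1 * G 1 ^+ 2) / s 0 + 1 / 16 * X +
    D1 * (b ^+ 2 * eta ^+ 2 / k / s 0) * U.
  have -> : \sum_(i < T) V i.+1 * ((s i)^-1 - (s i.+1)^-1) =
      D0 * \sum_(i < T) ((s i)^-1 - (s i.+1)^-1) +
      D1 * \sum_(i < T) G i.+1 ^+ 2 * ((s i)^-1 - (s i.+1)^-1).
    by rewrite !mulr_sumr -big_split/=; apply: eq_bigr => i _; rewrite /V; ring.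
  have t1 : \sum_(i < T) ((s i)^-1 - (s i.+1)^-1) <= (s 0)^-1.
    have -> : \sum_(i < T) ((s i)^-1 - (s i.+1)^-1) = (s 0)^-1 - (s T)^-1.
      elim: T {Hu Hab SF W X U tele} => [|T IH].
        by rewrite big_ord0 subrr.
      by rewrite big_ord_recr/= IH; lra.
    by rewrite gerDl oppr_le0 invr_ge0 ltW.
  have t2 := ler_wpM2l D0_ge0 t1.
  have X0 : 0 <= X.
    by apply: sumr_ge0 => i _; rewrite divr_ge0 ?sqr_ge0// ltW.
  have t3 := ler_wpM2r X0 D1th.
  (* This final boundary term enters [abel] with a minus sign and is discarded, which is why
     [theta <= 1] matters. *)
  have GT0 : 0 <= (1 - theta) * G T.+1 ^+ 2 / s T.
    by rewrite divr_ge0 ?mulr_ge0 ?sqr_ge0 ?subr_ge0// ltW.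
  rewrite big_split/= -!mulr_sumr -/X -/U in Hab.
  have Hab' := ler_wpM2l (ltW D1_gt0) Hab.
  have D1GT0 := mulr_ge0 (ltW D1_gt0) GT0.
  have -> : (D0 + D1 * G 1 ^+ 2) / s 0 = D0 / s 0 + D1 * (G 1 ^+ 2 / s 0).
    by ring.
  rewrite !mulrDr mulrN in Hab'.
  rewrite -[D1 * (_ / s 0) * U]mulrA; lra.
have VA' := ler_wpM2l eta33 VA.
have C0 : 0 <= b * eta ^+ 2 +
   eta * (33 / 32) * (D1 * (b ^+ 2 * eta ^+ 2 / k / s 0)).
  have : 0 <= b ^+ 2 * eta ^+ 2 / k / s 0.
    apply: divr_ge0 (ltW (s_gt0 0)); apply: divr_ge0 (ltW k0).
    by rewrite mulr_ge0 ?sqr_ge0.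
  move=> ?; apply: addr_ge0; first by rewrite mulr_ge0 ?sqr_ge0.
  by rewrite mulr_ge0// mulr_ge0// ltW.
have CU := ler_wpM2l C0 Hu.
move: tele VA' CU; set SV := \sum_(i < T) V i.+1 * _; set C := eta * (33 / 32).
set beta := D1 * (_ / _); set LN := 2 * _; set K := _ / s 0.
move: (b * eta ^+ 2) C beta LN K => *; lra.
Qed.

(** Telescopes sqrt(B + q) <= sqrt B + q / sqrt B, whose denominator is predictable. The shift [D]
    keeps the weights below [1 / sqrt D]: for [D = D0 * T] the additive noise then costs at most
    [sqrt (D0 * T)] over [T] steps. *)
Lemma sqrt_nu_le (D : R) T : 0 <= D ->
  Num.sqrt (nu T + D) <= Num.sqrt (nu 0%N + D) +
    \sum_(i < T) u i.+1 ^+ 2 * (Num.sqrt (nu i + D))^-1.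
Proof.
move=> D_ge0; elim: T => [|T IH]; first by rewrite big_ord0 addr0.
rewrite big_ord_recr/= addrA; apply: le_trans (lerD IH (lexx _)).
have B0 : 0 < nu T + D by rewrite ltr_pwDl// nu_gt0.
have r0 : 0 < Num.sqrt (nu T + D) by rewrite sqrtr_gt0.
have q0 : 0 <= u T.+1 ^+ 2 / Num.sqrt (nu T + D).
  by rewrite divr_ge0 ?sqr_ge0// ltW.
rewrite -ler_sqr ?nnegrE ?sqrtr_ge0 ?addr_ge0 ?(ltW r0)// sqr_sqrtr; last first.
  by rewrite addr_ge0// ltW// nu_gt0.
have e : nu T.+1 + D = nu T + D + u T.+1 ^+ 2 by rewrite nuS addrAC.
have e1 : Num.sqrt (nu T + D) * (u T.+1 ^+ 2 / Num.sqrt (nu T + D)) = u T.+1 ^+ 2.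
  by rewrite mulrC divfK// gt_eqF.
rewrite e sqrrD (sqr_sqrtr (ltW B0)) e1.
have := sqr_ge0 (u T.+1 ^+ 2 / Num.sqrt (nu T + D)).
by have := sqr_ge0 (u T.+1); lra.
Qed.

End Trajectory.

(** * Conditional expectations *)

Section MeasurableReal.
Context d (T : measurableType d) (R : realType).

Lemma measurable_inv_ge0 (h : T -> R) : measurable_fun [set: T] h ->
  (forall x, 0 <= h x) -> measurable_fun [set: T] (fun x => (h x)^-1).
Proof.
move=> mh h0; rewrite (_ : (fun x => _) = (fun x => h x `^ (-1))).
  by apply: (measurableT_comp (measurable_powR _) mh).
by apply/funext => x; rewrite powRN powRr1.
Qed.

Lemma measurable_sqrt_ge0 (h : T -> R) : measurable_fun [set: T] h ->
  (forall x, 0 <= h x) -> measurable_fun [set: T] (fun x => Num.sqrt (h x)).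
Proof.
move=> mh h0; rewrite (_ : (fun x => _) = (fun x => h x `^ 2^-1)).
  by apply: (measurableT_comp (measurable_powR _) mh).
by apply/funext => x; rewrite powR12_sqrt.
Qed.

Lemma measurable_sqr_enorm n (h : T -> 'rV[R]_n) :
  (forall i, measurable_fun [set: T] (fun x => h x ord0 i)) ->
  measurable_fun [set: T] (fun x => enorm (h x) ^+ 2).
Proof.
move=> mh; rewrite (_ : (fun x => _) = fun x => \sum_(i < n) h x ord0 i ^+ 2).
  by apply: measurable_sum => i; apply: measurable_funX.
by apply/funext => x; rewrite sqr_enorm.
Qed.

End MeasurableReal.

Section Expectation.
Context d (Omega : measurableType d) (R : realType) (P : probability Omega R).
Implicit Types X Y Z phi : Omega -> R.

Local Notation E X := (\int[P]_x X x).
Local Notation Int X := (P.-integrable [set: Omega] (EFin \o X)).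

Lemma integrable_cstR (c : R) : Int (fun=> c).
Proof. exact: finite_measure_integrable_cst. Qed.

Lemma integrableDR X Y : Int X -> Int Y -> Int (fun x => X x + Y x).
Proof. by move=> iX iY; exact: integrableD iX iY. Qed.

Lemma integrableBR X Y : Int X -> Int Y -> Int (fun x => X x - Y x).
Proof. by move=> iX iY; exact: integrableB iX iY. Qed.

Lemma integrableZR (c : R) X : Int X -> Int (fun x => c * X x).
Proof. by move=> iX; exact: integrableZl iX. Qed.

Lemma integrable_sumR (n : nat) (h : 'I_n -> Omega -> R) :
  (forall i, Int (h i)) -> Int (fun x => \sum_(i < n) h i x).
Proof.
elim: n h => [|n IH] h ih.
  by under [X in _.-integrable _ (_ \o X)]eq_fun do rewrite big_ord0;
    exact: integrable_cstR.
under [X in _.-integrable _ (_ \o X)]eq_fun do rewrite big_ord_recl.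
by apply: integrableDR => //; exact: IH.
Qed.

Lemma integrable_boundedM (M : R) phi X : measurable_fun [set: Omega] phi ->
  (forall x, `|phi x| <= M) -> Int X -> Int (fun x => phi x * X x).
Proof.
move=> mphi bphi iX; have := integrableMr measurableT mphi _ iX; apply.
by exists M; split => [|y My x _ /=]; rewrite ?num_real// (le_trans (bphi x))// ltW.
Qed.

Lemma integrable_bounded (M : R) phi : measurable_fun [set: Omega] phi ->
  (forall x, `|phi x| <= M) -> Int phi.
Proof.
move=> mphi bphi; have := integrable_boundedM mphi bphi (integrable_cstR 1).
by under [X in _.-integrable _ (_ \o X)]eq_fun do rewrite mulr1.
Qed.

Lemma Rintegral_cstT (c : R) : E (fun=> c) = c.
Proof. by rewrite Rintegral_cst//= (@probability_setT _ _ _ P) mulr1. Qed.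

Lemma Rintegral_sumR (n : nat) (h : 'I_n -> Omega -> R) :
  (forall i, Int (h i)) ->
  E (fun x => \sum_(i < n) h i x) = \sum_(i < n) E (h i).
Proof.
elim: n h => [|n IH] h ih.
  rewrite big_ord0 -[RHS](Rintegral_cstT 0).
  by apply: eq_Rintegral => x _; rewrite big_ord0.
rewrite big_ord_recl -IH// -RintegralD//; last exact: integrable_sumR.
by apply: eq_Rintegral => x _; rewrite big_ord_recl.
Qed.

(** Almost everywhere [Y - X] coincides with its absolute value, whose integral is nonnegative. *)
Lemma ae_le_Rintegral X Y : Int X -> Int Y ->
  {ae P, forall x, X x <= Y x} -> E X <= E Y.
Proof.
move=> iX iY XY; rewrite -subr_ge0 -RintegralB//.
have iYX := integrableBR iY iX.
suff -> : E (fun x => Y x - X x) = E (fun x => `|Y x - X x|).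
  exact: Rintegral_ge0.
congr fine; apply: ae_eq_integral => //.
- exact: measurable_int iYX.
- have /measurable_int : Int (fun x => `|Y x - X x|) by exact: integrable_norm iYX.
  exact.
- by apply: filterS XY => x XYx _ /=; rewrite ger0_norm// subr_ge0.
Qed.

(* The sum is h * floor (y / h), written with the indicators of the level sets. *)
Lemma floor_sum (h y : R) N : 0 < h -> 0 <= y -> y < N%:R * h ->
  `|y - h * \sum_(k < N) (k.+1%:R * h <= y)%R%:R| <= h.
Proof.
move=> h0 y0 yN; set S := fun N => \sum_(k < N) ((k.+1%:R * h <= y)%R%:R : R).
have : (N%:R * h <= y -> S N = N%:R) /\
       (y < N%:R * h -> h * S N <= y < h * S N + h).
  elim: N {yN} => [|N [IH1 IH2]].
    by rewrite /S big_ord0 mul0r; split => // /lt_le_trans/(_ y0); rewrite ltxx.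
  rewrite /S big_ord_recr/= -/(S N) -natr1 mulrDl mul1r; split => yN.
    by rewrite yN IH1// (le_trans _ yN)// lerDl ltW.
  rewrite [N%:R * h + h <= y]leNgt yN/= addr0; case: (leP (N%:R * h) y) => [Ny|/IH2//].
  by rewrite IH1// mulrC Ny.
by case=> _ /(_ yN); rewrite ler_norml -/(S N) => /andP[]; lra.
Qed.

Section Pull.
Variables (F : set (set Omega)) (X Y : Omega -> R).
Hypotheses (F_meas : F `<=` measurable) (F_setT : F setT).
Hypothesis XY : is_cond_exp P F X Y.

(** [Z = X - Y] integrates to 0 over every set of [F], hence against combinations of indicators of
    level sets of [phi]. These approximate [phi] uniformly within any [h > 0], so the error is at
    most [h] times the integral of [|Z|]. *)
Lemma cond_exp_pull (M : R) phi :
  (forall B, measurable B -> F (phi @^-1` B)) -> (forall x, `|phi x| <= M) ->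
  E (fun x => phi x * X x) = E (fun x => phi x * Y x).
Proof.
move=> Fphi bphi.
have iX := cond_exp_integrableX XY; have iY := cond_exp_integrable XY.
pose Z x := X x - Y x; have iZ : Int Z := integrableBR iX iY.
have mphi : measurable_fun [set: Omega] phi.
  by move=> _ B mB; rewrite setTI; apply/F_meas/Fphi.
have ZA A : F A -> Int (fun x => \1_A x * Z x) /\ E (fun x => \1_A x * Z x) = 0.
  move=> FA; have mA := F_meas FA; split.
    apply: (@integrable_boundedM 1) => // x.
    by rewrite indicE; case: (_ \in _); rewrite ?normr1 ?normr0.
  have -> : E (fun x => \1_A x * Z x) = \int[P]_(x in A) Z x.
    rewrite [RHS]Rintegral_mkcond; apply: eq_Rintegral => x _.
    by rewrite patchE indicE; case: (x \in A); rewrite ?mul1r ?mul0r.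
  rewrite RintegralB//; [|exact: integrableS iX|exact: integrableS iY].
  by rewrite /Rintegral (cond_exp_integral XY FA) subrr.
have M0 : 0 <= M by rewrite (le_trans (normr_ge0 _) (bphi point)).
suff EZ : E (fun x => phi x * Z x) = 0.
  apply/eqP; rewrite -subr_eq0 -RintegralB//; last 2 first.
  - exact: integrable_boundedM iX.
  - exact: integrable_boundedM iY.
  by apply/eqP; rewrite -[RHS]EZ; apply: eq_Rintegral => x _; rewrite mulrBr.
have iphiZ : Int (fun x => phi x * Z x) by exact: integrable_boundedM iZ.
have iaZ : Int (fun x => `|Z x|) by exact: integrable_norm.
have key h : 0 < h -> `|E (fun x => phi x * Z x)| <= h * E (fun x => `|Z x|).
  move=> h0.
  (* Enough levels of height [h] to cover the range of [phi + M], contained in [[0, 2 * M]]. *)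
  pose N := (Num.truncn (2 * M / h)).+1.
  have yN x : phi x + M < N%:R * h.
    rewrite -ltr_pdivrMr//; apply: le_lt_trans (truncnS_gt _).
    rewrite ler_wpM2r ?invr_ge0 ?(ltW h0)//.
    by have := bphi x; rewrite ler_norml => /andP[]; lra.
  have y0 x : 0 <= phi x + M.
    by have := bphi x; rewrite ler_norml => /andP[]; lra.
  pose A (k : 'I_N) := [set x | k.+1%:R * h <= phi x + M].
  have FA k : F (A k).
    have -> : A k = phi @^-1` `[k.+1%:R * h - M, +oo[.
      by apply/seteqP; split => x; rewrite /A/= in_itv/= andbT lerBlDr.
    by apply: Fphi; exact: measurable_itv.
  (* The shift by [M] undoes the one that made [phi + M] nonnegative; as a multiple of the indicator
     of [setT] it also integrates to 0 against [Z]. *)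
  pose psi x := h * (\sum_(k < N) \1_(A k) x) - M.
  have psiE x : psi x * Z x =
      h * (\sum_(k < N) \1_(A k) x * Z x) - M * (\1_setT x * Z x).
    by rewrite /psi mulrBl -mulrA mulr_suml indicT mul1r.
  have iS : Int (fun x => \sum_(k < N) \1_(A k) x * Z x).
    by apply: integrable_sumR => k; case: (ZA _ (FA k)).
  have [iT ET] := ZA _ F_setT.
  have ipsi : Int (fun x => psi x * Z x).
    under [X in _.-integrable _ (_ \o X)]eq_fun do rewrite psiE.
    by apply: integrableBR; exact: integrableZR.
  have Epsi : E (fun x => psi x * Z x) = 0.
    under eq_Rintegral do rewrite psiE.
    rewrite RintegralB//; [|exact: integrableZR|exact: integrableZR].
    rewrite !RintegralZl// ET mulr0 subr0 Rintegral_sumR; last first.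
      by move=> k; case: (ZA _ (FA k)).
    by rewrite big1 ?mulr0// => k _; case: (ZA _ (FA k)).
  rewrite -[E (fun x => phi x * Z x)]subr0 -Epsi -RintegralB//.
  apply: le_trans (le_normr_Rintegral _ _) _ => //; first exact: integrableBR.
  rewrite -RintegralZl//; apply: le_Rintegral => //.
  - by apply: integrable_norm => //; exact: integrableBR.
  - exact: integrableZR.
  - move=> x _; rewrite -mulrBl normrM ler_wpM2r//.
    have := floor_sum h0 (y0 x) (yN x).
    rewrite (_ : phi x - psi x = phi x + M - h * \sum_(k < N) \1_(A k) x).
      congr (`|_ - _ * _| <= _); apply: eq_bigr => k _.
      rewrite indicE; congr ((nat_of_bool _)%:R); apply/idP/idP.
        by rewrite inE.
      by rewrite inE.
    by rewrite /psi; ring.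
apply/eqP; rewrite -normr_le0; apply/ler_addgt0Pr => e e0; rewrite add0r.
have EZ0 : 0 <= E (fun x => `|Z x|) by apply: Rintegral_ge0.
have E1 : 0 < E (fun x => `|Z x|) + 1 by lra.
(* The added 1 covers the case where the integral of [|Z|] vanishes. *)
apply: le_trans (key (e / (E (fun x => `|Z x|) + 1)) _) _.
  by rewrite divr_gt0.
by rewrite mulrAC ler_pdivrMr// ler_pM2l//; lra.
Qed.

End Pull.

Lemma cond_exp_pull_le (F : set (set Omega)) X V (W : Omega -> R) (M K : R) phi :
  F `<=` measurable -> F setT -> is_cond_exp P F X V ->
  measurable_fun [set: Omega] W -> (forall x, `|W x| <= K) ->
  {ae P, forall x, V x <= W x} ->
  (forall B, measurable B -> F (phi @^-1` B)) ->
  (forall x, 0 <= phi x <= M) ->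
  E (fun x => X x * phi x) <= E (fun x => W x * phi x).
Proof.
move=> FM FT XV mW bW VW Fphi phi0.
have bphi x : `|phi x| <= M by have /andP[p0 pM] := phi0 x; rewrite ger0_norm.
have mphi : measurable_fun [set: Omega] phi.
  by move=> _ B mB; rewrite setTI; apply/FM/Fphi.
under eq_Rintegral do rewrite mulrC.
rewrite (cond_exp_pull FM FT XV Fphi bphi).
under [leRHS]eq_Rintegral do rewrite mulrC.
apply: ae_le_Rintegral.
- exact: integrable_boundedM (cond_exp_integrable XV).
- by apply: integrable_boundedM mphi bphi _; exact: integrable_bounded mW bW.
- by apply: filterS VW => x Vx; rewrite ler_wpM2l//; case/andP: (phi0 x).
Qed.

Lemma markov_le1 (Y : Omega -> R) (delta : R) : Int Y -> (forall x, 0 <= Y x) -> E Y <= 1 ->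
  0 < delta -> ((1 - delta)%:E <= P [set x | (Y x <= delta^-1)%R])%E.
Proof.
move=> iY Y0 EY d0.
have mY : measurable_fun [set: Omega] Y by apply/measurable_EFinP/measurable_int/iY.
have mA : measurable [set x | delta^-1 < Y x].
  rewrite (_ : [set x | _] = Y @^-1` `]delta^-1, +oo[).
    by rewrite -[_ @^-1` _]setTI; apply: mY => //; exact: measurable_itv.
  by apply/seteqP; split => x /=; rewrite in_itv/= andbT.
have -> : [set x | Y x <= delta^-1] = ~` [set x | delta^-1 < Y x].
  by apply/seteqP; split => x /=; rewrite leNgt; move/negP.
rewrite probability_setC// EFinB; apply: leeB => //.
set A := [set x | delta^-1 < Y x] in mA *.
have iA : Int (fun x => delta^-1 * \1_A x).
  by apply: integrableZR; exact: integrable_indic.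
have : E (fun x => delta^-1 * \1_A x) <= E Y.
  apply: le_Rintegral => // x _; rewrite indicE.
  case: (boolP (x \in A)); rewrite ?mulr1 ?mulr0// inE => Ax; exact: ltW.
rewrite RintegralZl//; last exact: integrable_indic.
rewrite /Rintegral integral_indic// setIT => h.
have := le_trans h EY; rewrite mulrC ler_pdivrMr// mul1r.
by rewrite -lee_fin fineK// fin_num_measure.
Qed.

End Expectation.

(* X and S stand for the expectations of sum_t G_t^2 / sqrt(nu_(t-1)) and of
   sqrt(nu_T).  A large fixed c gives the bound on S, then c = 1 + r the bound
   on X. *)
Lemma moment_bootstrap (R : realType) (s0 D1 eta C0 C1 : R) :
  0 < s0 -> 0 < D1 -> 0 < eta -> 0 <= C0 -> 0 <= C1 ->
  exists A B : R, [/\ 0 < A, 0 < B & forall r X S : R, 0 <= r -> 0 <= X -> 0 <= S ->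
    (forall c, 0 < c -> eta * X <=
      C0 + C1 * (2 * (ln c + S / (s0 * c) - 1)) +
      eta * (33 / 32) * (1 / 4 * X + 1 / 16 * X)) ->
    S <= s0 + 2 * r + D1 * X ->
    S <= A * (1 + r) /\ X <= B * (1 + ln (1 + r))].
Proof.
move=> s00 D10 eta0 C00 C10.
pose k0 := 2 * C0 / eta; pose k1 := 4 * C1 / eta.
have k00 : 0 <= k0 by rewrite divr_ge0 ?mulr_ge0// ltW.
have k10 : 0 <= k1 by rewrite divr_ge0 ?mulr_ge0// ltW.
(* Chosen so that [D1 * k1 / (s0 * c) <= 1 / 2]: half of [S] can then be absorbed on the left. *)
pose c := 1 + 2 * D1 * k1 / s0.
have Dk : 0 <= D1 * k1 := mulr_ge0 (ltW D10) k10.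
have c1 : 1 <= c.
  by rewrite /c lerDl divr_ge0 ?(ltW s00)// -mulrA mulr_ge0.
have c0 : 0 < c by exact: lt_le_trans c1.
have lnc0 := ln_ge0 c1.
pose A := 2 * (s0 + 2 + D1 * k0 + D1 * k1 * ln c).
pose B := 1 + k0 + k1 + k1 * A / s0.
have Dk0 : 0 <= D1 * k0 := mulr_ge0 (ltW D10) k00.
have Dk1 : 0 <= D1 * k1 * ln c := mulr_ge0 Dk lnc0.
have A0 : 0 < A by rewrite /A mulr_gt0//; lra.
have kA : 0 <= k1 * A / s0.
  exact: divr_ge0 (mulr_ge0 k10 (ltW A0)) (ltW s00).
have B0 : 0 < B by rewrite /B; lra.
exists A, B; split => // r X S r0 X0 S0 HX HS.
(* 33/32 (1/4 + 1/16) = 165/512 < 1/2, so more than half of [eta * X] stays on the left; this gives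
   the factors 2 and 4 in [k0] and [k1]. *)
have X_le e : 0 < e -> X <= k0 + k1 * (ln e + S / (s0 * e) - 1).
  move=> e0; have := HX _ e0; set t := ln e + _ - 1 => H.
  have eX : 0 <= eta * X by rewrite mulr_ge0// ltW.
  rewrite -(ler_pM2l eta0).
  have -> : eta * (k0 + k1 * t) = 2 * C0 + 4 * (C1 * t).
    by rewrite /k0 /k1; field; rewrite gt_eqF.
  have e1 : C1 * (2 * t) = 2 * (C1 * t) by ring.
  rewrite e1 in H; lra.
have S_le : S <= A * (1 + r).
  have := ler_wpM2l (ltW D10) (X_le _ c0).
  have : D1 * k1 * (S / (s0 * c)) <= 1 / 2 * S.
    rewrite mulrA ler_pdivrMr ?mulr_gt0//.
    have -> : 1 / 2 * S * (s0 * c) = 1 / 2 * s0 * S + D1 * k1 * S.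
      by rewrite /c; field; rewrite gt_eqF.
    by rewrite lerDr mulr_ge0// mulr_ge0 ?(ltW s00)//; lra.
  have -> : D1 * (k0 + k1 * (ln c + S / (s0 * c) - 1)) =
    D1 * k0 + D1 * k1 * ln c + D1 * k1 * (S / (s0 * c)) - D1 * k1 by ring.
  have : 0 <= 2 * (s0 + D1 * k0 + D1 * k1 * ln c) * r.
    by rewrite mulr_ge0// mulr_ge0// !addr_ge0// ltW.
  have -> : A * (1 + r) = 2 * (s0 + 2 + D1 * k0 + D1 * k1 * ln c) +
    (2 * (s0 + D1 * k0 + D1 * k1 * ln c) * r + 4 * r) by rewrite /A; ring.
  move: HS; lra.
split => //.
have r1 : 0 < 1 + r by lra.
have l0 : 0 <= ln (1 + r) by rewrite ln_ge0// lerDl.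
have Sr : k1 * (S / (s0 * (1 + r))) <= k1 * A / s0.
  rewrite -mulrA ler_wpM2l// ler_pdivrMr ?mulr_gt0//.
  by rewrite mulrA divfK ?gt_eqF.
have := X_le _ r1.
have -> : k1 * (ln (1 + r) + S / (s0 * (1 + r)) - 1) =
  k1 * ln (1 + r) + k1 * (S / (s0 * (1 + r))) - k1 by ring.
have -> : B * (1 + ln (1 + r)) = 1 + k0 + k1 + k1 * A / s0 +
  ((1 + k0 + k1 * A / s0) * ln (1 + r) + k1 * ln (1 + r)).
  by rewrite /B; ring.
have : 0 <= (1 + k0 + k1 * A / s0) * ln (1 + r) by rewrite mulr_ge0// !addr_ge0.
lra.
Qed.

Lemma min_sq_grad_le (R : realType) (n : nat) (f : 'rV[R]_n -> R)
    (w : nat -> 'rV[R]_n) T i : (i < T)%N ->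
  min_sq_grad f w T <= enorm (grad f (w i.+1)) ^+ 2.
Proof.
move=> iT; apply: bigmin_inf_seq (lexx _) => //.
by rewrite mem_index_iota ltnS.
Qed.

(** * AdaGrad-Norm *)

Section AdaGradNorm.
Variables (R : realType) (n : nat) (f : 'rV[R]_n -> R) (L0 L1 : R).
Context (d : measure_display) (Omega : measurableType d).
Variables (P : probability Omega R) (eta nu0 D0 D1 : R) (w1 : 'rV[R]_n).
Variables (g : nat -> Omega -> 'rV[R]_n) (nu : nat -> Omega -> R).
Variable (w : nat -> Omega -> 'rV[R]_n).
Hypotheses (L0_gt0 : 0 < L0) (L1_gt0 : 0 < L1).
Hypothesis f_smooth : forall u v : 'rV[R]_n, enorm (u - v) <= 1 / L1 ->
  enorm (grad f u - grad f v) <=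
    (L1 * enorm (grad f u) + L0) * enorm (u - v).
Hypothesis nu0_gt0 : 0 < nu0.
Hypothesis g_random : forall t, (1 <= t)%N -> random_vector (g t).
Hypothesis w_adagrad : adagrad_norm eta w1 nu0 g nu w.
Hypotheses (D0_ge0 : 0 <= D0) (D1_gt0 : 0 < D1) (eta_gt0 : 0 < eta).
Hypothesis g_unbiased : forall t, (1 <= t)%N -> forall i : 'I_n,
  is_cond_exp P (grad_filtration g t)
    (fun x => g t x ord0 i) (fun x => grad f (w t x) ord0 i).
Hypothesis g_affine_variance : forall t, (1 <= t)%N ->
  exists2 V : Omega -> R,
    is_cond_exp P (grad_filtration g t) (fun x => enorm (g t x) ^+ 2) V &
    {ae P, forall x, V x <= D0 + D1 * enorm (grad f (w t x)) ^+ 2}.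

Local Notation E X := (\int[P]_x X x).
Local Notation Int X := (P.-integrable [set: Omega] (EFin \o X)).

Let s t x := Num.sqrt (nu t x).
Let G t x := enorm (grad f (w t x)).
Let u t x := enorm (g t x).
Let V t x := D0 + D1 * G t x ^+ 2.

Lemma nuS t x : nu t.+1 x = nu t x + u t.+1 x ^+ 2.
Proof. exact: (adagrad_nu w_adagrad). Qed.

Lemma nu_ge t x : nu0 <= nu t x.
Proof.
elim: t => [|t IH]; first by rewrite (adagrad_nu0 w_adagrad).
by rewrite nuS (le_trans IH)// lerDl sqr_ge0.
Qed.

Lemma nu_le r t x : (r <= t)%N -> nu r x <= nu t x.
Proof.
elim: t => [|t IH]; first by rewrite leqn0 => /eqP->.
rewrite leq_eqVlt => /orP[/eqP->//|rt].
by rewrite nuS (le_trans (IH rt))// lerDl sqr_ge0.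
Qed.

Let nu_gt0 t x : 0 < nu t x.
Proof. exact: lt_le_trans (nu_ge t x). Qed.

Let nu_ge0 t x : 0 <= nu t x. Proof. exact: ltW. Qed.

Let s_gt0 t x : 0 < s t x.
Proof. by rewrite sqrtr_gt0. Qed.

Let sqr_s t x : s t x ^+ 2 = nu t x.
Proof. by rewrite sqr_sqrtr. Qed.

Lemma sqrt_nu0_le t x : Num.sqrt nu0 <= s t x.
Proof. by rewrite ler_wsqrtr// nu_ge. Qed.

Lemma inv_s_le t x : (s t x)^-1 <= (Num.sqrt nu0)^-1.
Proof. by rewrite lef_pV2 ?posrE ?sqrtr_gt0 ?nu_gt0// sqrt_nu0_le. Qed.

Let V_ge0 t x : 0 <= V t x.
Proof. by rewrite addr_ge0// mulr_ge0 ?sqr_ge0// ltW. Qed.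

Lemma enorm_step t x :
  enorm (w t.+2 x - w t.+1 x) = eta * u t.+1 x / s t.+1 x.
Proof.
rewrite (adagrad_w w_adagrad)// addrC addKr enormN enormZ ger0_norm.
  by rewrite mulrAC.
by rewrite divr_ge0 ?ltW// s_gt0.
Qed.

Lemma enorm_step_le t x : enorm (w t.+2 x - w t.+1 x) <= eta.
Proof.
rewrite enorm_step -mulrA ler_piMr ?(ltW eta_gt0)// ler_pdivrMr ?s_gt0// mul1r.
by rewrite -ler_sqr ?nnegrE ?enorm_ge0 ?sqrtr_ge0// sqr_s nuS lerDr.
Qed.

Lemma enorm_from_start_le t x : enorm (w1 - w t.+1 x) <= t%:R * eta.
Proof.
elim: t => [|t IH].
  by rewrite (adagrad_w1 w_adagrad) subrr enorm0 mul0r.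
rewrite -natr1 mulrDl mul1r (le_trans _ (lerD IH (enorm_step_le t x)))//.
rewrite [X in _ <= _ + X]enormB.
have -> : w1 - w t.+2 x = (w1 - w t.+1 x) + (w t.+1 x - w t.+2 x).
  by rewrite addrA subrK.
exact: ler_enormD.
Qed.

(** The iterate lies within [t * eta] of the deterministic [w1], so [smooth_chain] from [w1]
    applies. The bound depends on [t] and serves only to make test functions bounded and products
    integrable; it does not enter the final constant. *)
Lemma grad_le t : exists2 K : R, 0 <= K & forall x, G t.+1 x <= K.
Proof.
pose m := (Num.truncn (t%:R * eta * L1)).+1.
pose K := 2 ^+ m * (L1 * enorm (grad f w1) + L0) * (t%:R * eta).
have h0 : 0 <= 2 ^+ m * (L1 * enorm (grad f w1) + L0).
  by rewrite mulr_ge0 ?exprn_ge0// addr_ge0 ?mulr_ge0 ?enorm_ge0// ltW.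
exists (enorm (grad f w1) + K).
  by rewrite addr_ge0 ?enorm_ge0// mulr_ge0// mulr_ge0// ltW.
move=> x; have wt := enorm_from_start_le t x.
have wm : enorm (w1 - w t.+1 x) <= m%:R / L1.
  by rewrite (le_trans wt)// ler_pdivlMr// ltW// truncnS_gt.
have gt := smooth_chain L0_gt0 L1_gt0 f_smooth wm.
have -> : G t.+1 x = enorm (grad f w1 + - (grad f w1 - grad f (w t.+1 x))).
  by rewrite opprB addrC subrK.
rewrite (le_trans (ler_enormD _ _))// lerD2l enormN (le_trans gt)//.
by rewrite ler_wpM2l.
Qed.

(** * Adapted processes and predictable test functions *)

Lemma grad_filtration_sub t : grad_filtration g t `<=` measurable.
Proof.
apply: smallest_sub; first exact: sigma_algebra_measurable.
move=> A [r /= /andP[r1 _] [i _ [B mB <-]]].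
by rewrite setTI -[_ @^-1` _]setTI; exact: g_random.
Qed.

Let gens t := \bigcup_(r in [set r | (1 <= r < t)%N]) \bigcup_(i in [set: 'I_n])
  preimage_set_system [set: Omega] (fun x => g r x ord0 i) measurable.

(** [Omega] equipped with F_t as its measurable structure: measurability with respect to F_t becomes
    plain [measurable_fun]. [TF t.+1] knows g_1, ..., g_t, hence [nu t] and [s t]. *)
Let TF t := g_sigma_algebraType (gens t).

Let adapted t (phi : Omega -> R) : measurable_fun [set: TF t] (phi : TF t -> R) ->
  forall B, measurable B -> grad_filtration g t (phi @^-1` B).
Proof. by move=> mphi B mB; have := mphi measurableT B mB; rewrite setTI. Qed.

Let measurable_adapted t (phi : Omega -> R) :
  measurable_fun [set: TF t] (phi : TF t -> R) -> measurable_fun [set: Omega] phi.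
Proof.
by move=> mphi _ B mB; rewrite setTI; exact: grad_filtration_sub (adapted mphi mB).
Qed.

Let filtration_setT t : grad_filtration g t setT.
Proof. exact: (@measurableT _ (TF t)). Qed.

Let g_adapted r t i : (1 <= r < t)%N ->
  measurable_fun [set: TF t] (fun x : TF t => g r x ord0 i).
Proof.
move=> rt _ B mB; apply: sub_sigma_algebra; exists r => //; exists i => //.
by exists B.
Qed.

(** Measurability is read off [g_unbiased]: a version of a conditional expectation given F_t is
    F_t-measurable. *)
Let grad_adapted t i :
  measurable_fun [set: TF t.+1] (fun x : TF t.+1 => grad f (w t.+1 x) ord0 i).
Proof.
by move=> _ B mB; rewrite setTI; apply: (cond_exp_measurable (g_unbiased _ i)).
Qed.

Let nu_adapted t r : (r <= t)%N ->
  measurable_fun [set: TF t.+1] (nu r : TF t.+1 -> R).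
Proof.
elim: r => [|r IH] rt.
  rewrite (_ : nu 0%N = fun=> nu0)//.
  by apply/funext => x; rewrite (adagrad_nu0 w_adagrad).
rewrite (_ : nu r.+1 = fun x => nu r x + u r.+1 x ^+ 2); last first.
  by apply/funext => x; rewrite nuS.
apply: measurable_funD; first by apply: IH; exact: ltnW.
by apply: measurable_sqr_enorm => i; apply: g_adapted.
Qed.

Let s_adapted t : measurable_fun [set: TF t.+1] (s t : TF t.+1 -> R).
Proof. by apply: measurable_sqrt_ge0 => //; exact: nu_adapted. Qed.

Let inv_s_adapted t :
  measurable_fun [set: TF t.+1] ((fun x => (s t x)^-1) : TF t.+1 -> R).
Proof. by apply: measurable_inv_ge0 => // x; exact: sqrtr_ge0. Qed.

Let sqr_G_adapted t :
  measurable_fun [set: TF t.+1] ((fun x => G t.+1 x ^+ 2) : TF t.+1 -> R).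
Proof. by apply: measurable_sqr_enorm => i; exact: grad_adapted. Qed.

Let V_adapted t : measurable_fun [set: TF t.+1] (V t.+1 : TF t.+1 -> R).
Proof. by apply: measurable_funD => //; apply: measurable_funM. Qed.

Lemma V_bounded t : exists K : R, forall x, `|V t.+1 x| <= K.
Proof.
have [K K0 GK] := grad_le t; exists (D0 + D1 * K ^+ 2) => x.
rewrite ger0_norm// lerD2l ler_pM2l// ler_sqr ?nnegrE ?enorm_ge0//.
Qed.

Lemma integrable_sqr_u t : Int (fun x => u t.+1 x ^+ 2).
Proof.
by have [W /cond_exp_integrableX] := g_affine_variance (isT : (1 <= t.+1)%N).
Qed.

Let dot_gradE t (phi : Omega -> R) x :
  phi x * dotv (grad f (w t x)) (g t x) =
  \sum_(i < n) phi x * grad f (w t x) ord0 i * g t x ord0 i.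
Proof.
by rewrite /dotv mulr_sumr; apply: eq_bigr => i _; rewrite mulrA.
Qed.

(** Unbiasedness is stated by coordinates, so the inner product is expanded and each coordinate is
    tested against [phi] times the matching partial derivative, bounded by [grad_le]. *)
Lemma expectation_dot t (phi : Omega -> R) (M : R) :
  measurable_fun [set: TF t.+1] (phi : TF t.+1 -> R) ->
  (forall x, `|phi x| <= M) ->
  Int (fun x => phi x * dotv (grad f (w t.+1 x)) (g t.+1 x)) /\
  E (fun x => phi x * dotv (grad f (w t.+1 x)) (g t.+1 x)) =
  E (fun x => phi x * G t.+1 x ^+ 2).
Proof.
move=> mphi bphi; have [K K0 GK] := grad_le t.
have M0 : 0 <= M by rewrite (le_trans (normr_ge0 _) (bphi point)).
pose psi (i : 'I_n) x := phi x * grad f (w t.+1 x) ord0 i.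
have mpsi i : measurable_fun [set: TF t.+1] (psi i : TF t.+1 -> R).
  exact: measurable_funM.
have bpsi i x : `|psi i x| <= M * K.
  by rewrite normrM ler_pM// (le_trans (abs_coord_le_enorm _ _) (GK x)).
have ce i := g_unbiased (isT : (1 <= t.+1)%N) i.
have iX i : Int (fun x => psi i x * g t.+1 x ord0 i).
  apply: integrable_boundedM (bpsi i) (cond_exp_integrableX (ce i)).
  exact: measurable_adapted (mpsi i).
have iY i : Int (fun x => psi i x * grad f (w t.+1 x) ord0 i).
  apply: integrable_boundedM (bpsi i) (cond_exp_integrable (ce i)).
  exact: measurable_adapted (mpsi i).
split.
  under [X in _.-integrable _ (_ \o X)]eq_fun do rewrite dot_gradE.
  exact: integrable_sumR.
under eq_Rintegral do rewrite dot_gradE.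
rewrite Rintegral_sumR//.
transitivity (E (fun x => \sum_(i < n) psi i x * grad f (w t.+1 x) ord0 i)).
  rewrite Rintegral_sumR//; apply: eq_bigr => i _.
  apply: (cond_exp_pull _ _ (ce i) _ (bpsi i)).
  - exact: grad_filtration_sub.
  - exact: filtration_setT.
  - exact: adapted.
apply: eq_Rintegral => x _.
rewrite sqr_enorm mulr_sumr; apply: eq_bigr => i _.
by rewrite /psi expr2 mulrA.
Qed.

Lemma expectation_sqr_u_le t (phi : Omega -> R) (M : R) :
  measurable_fun [set: TF t.+1] (phi : TF t.+1 -> R) ->
  (forall x, 0 <= phi x <= M) ->
  Int (fun x => u t.+1 x ^+ 2 * phi x) /\
  E (fun x => u t.+1 x ^+ 2 * phi x) <= E (fun x => V t.+1 x * phi x).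
Proof.
move=> mphi bphi.
have [W ce WV] := g_affine_variance (isT : (1 <= t.+1)%N).
have [K VK] := V_bounded t.
split.
  under [X in _.-integrable _ (_ \o X)]eq_fun do rewrite mulrC.
  apply: (@integrable_boundedM _ _ _ _ M); last exact: integrable_sqr_u.
    exact: measurable_adapted mphi.
  by move=> x; have /andP[p0 pM] := bphi x; rewrite ger0_norm.
apply: (cond_exp_pull_le _ _ ce _ VK WV _ bphi).
- exact: grad_filtration_sub.
- exact: filtration_setT.
- exact: measurable_adapted (@V_adapted t).
- exact: adapted.
Qed.

(* Jensen gives G^2 <= E[|g|^2 | F] <= D0 + D1 G^2 almost surely; here it is
   obtained by testing against phi, the positive part of (1 - D1) G^2 - D0. *)
Lemma ae_sqr_grad_le t :
  {ae P, forall x, (1 - D1) * G t.+1 x ^+ 2 <= D0}.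
Proof.
pose z x := (1 - D1) * G t.+1 x ^+ 2 - D0.
pose phi x := Num.max (z x) 0.
have [K K0 GK] := grad_le t.
have mz : measurable_fun [set: TF t.+1] (z : TF t.+1 -> R).
  by apply: measurable_funB => //; exact: measurable_funM.
have mphi : measurable_fun [set: TF t.+1] (phi : TF t.+1 -> R).
  exact: measurable_maxr.
have phi0 x : 0 <= phi x by rewrite /phi le_max lexx orbT.
have phiz x : z x <= phi x by rewrite /phi le_max lexx.
have phiM x : phi x <= K ^+ 2.
  rewrite /phi ge_max sqr_ge0 andbT /z.
  have : G t.+1 x ^+ 2 <= K ^+ 2 by rewrite ler_sqr ?nnegrE ?enorm_ge0.
  have : 0 <= D1 * G t.+1 x ^+ 2 by rewrite mulr_ge0 ?sqr_ge0// ltW.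
  by have := D0_ge0; rewrite mulrBl mul1r; lra.
have bphi x : `|phi x| <= K ^+ 2 by rewrite ger0_norm.
have [idot Edot] := expectation_dot mphi bphi.
have [iu Eu] : Int (fun x => u t.+1 x ^+ 2 * phi x) /\
    E (fun x => u t.+1 x ^+ 2 * phi x) <= E (fun x => V t.+1 x * phi x).
  by apply: (@expectation_sqr_u_le _ _ (K ^+ 2)) => // x; rewrite phi0 phiM.
have mphi' := measurable_adapted mphi.
have iG : Int (fun x => phi x * G t.+1 x ^+ 2).
  apply: (integrable_boundedM mphi' bphi).
  apply: (@integrable_bounded _ _ _ _ (K ^+ 2)).
    exact: measurable_adapted (@sqr_G_adapted t).
  by move=> x; rewrite ger0_norm ?sqr_ge0// ler_sqr ?nnegrE ?enorm_ge0.
have iV : Int (fun x => V t.+1 x * phi x).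
  have [K' VK] := V_bounded t.
  apply: (integrable_boundedM (measurable_adapted (@V_adapted t)) VK).
  exact: integrable_bounded mphi' bphi.
have iphi2 : Int (fun x => phi x * phi x).
  by apply: (integrable_boundedM mphi' bphi); exact: integrable_bounded mphi' bphi.
(* By [expectation_dot] the gap is the expectation of [phi] times |g - grad f|^2 in expanded form,
   which Cauchy-Schwarz bounds below by [phi * (G - u) ^+ 2]. *)
have h1 : E (fun x => phi x * G t.+1 x ^+ 2) <=
          E (fun x => u t.+1 x ^+ 2 * phi x).
  rewrite -subr_ge0; have -> : E (fun x => u t.+1 x ^+ 2 * phi x) -
      E (fun x => phi x * G t.+1 x ^+ 2) =
      E (fun x => (u t.+1 x ^+ 2 * phi x + phi x * G t.+1 x ^+ 2)
        - 2 * (phi x * dotv (grad f (w t.+1 x)) (g t.+1 x))).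
    rewrite RintegralB//; [|exact: integrableDR|exact: integrableZR].
    by rewrite RintegralD// RintegralZl// Edot; lra.
  apply: Rintegral_ge0 => x _.
  have -> : u t.+1 x ^+ 2 * phi x + phi x * G t.+1 x ^+ 2 -
    2 * (phi x * dotv (grad f (w t.+1 x)) (g t.+1 x)) =
    phi x * (u t.+1 x ^+ 2 + G t.+1 x ^+ 2
      - 2 * dotv (grad f (w t.+1 x)) (g t.+1 x)) by ring.
  apply: mulr_ge0 => //.
  have := dotv_le_enorm (grad f (w t.+1 x)) (g t.+1 x).
  have := sqr_ge0 (G t.+1 x - u t.+1 x).
  by rewrite sqrrB -/(G t.+1 x) -/(u t.+1 x); lra.
(* Where [phi] is nonzero it equals [z = G ^+ 2 - V], so its square is [phi * (G ^+ 2 - V)]. *)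
have h2 : E (fun x => phi x * phi x) <= 0.
  have -> : E (fun x => phi x * phi x) =
     E (fun x => phi x * G t.+1 x ^+ 2 - V t.+1 x * phi x).
    apply: eq_Rintegral => x _.
    have -> : phi x * G t.+1 x ^+ 2 - V t.+1 x * phi x = z x * phi x.
      by rewrite /z /V; ring.
    by rewrite /phi; case: (leP (z x) 0) => _; rewrite ?mulr0.
  by rewrite RintegralB// subr_le0 (le_trans h1 Eu).
have h3 : E (fun x => `|phi x * phi x|) = 0.
  transitivity (E (fun x => phi x * phi x)).
    by apply: eq_Rintegral => x _; rewrite ger0_norm// mulr_ge0.
  by apply/eqP; rewrite eq_le h2/=; apply: Rintegral_ge0 => x _; exact: mulr_ge0.
have m2 : measurable_fun [set: Omega] (EFin \o (fun x => phi x * phi x)).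
  exact: measurable_int iphi2.
have /(ae_eq_integral_abs P measurableT m2) : (\int[P]_x `|(phi x * phi x)%:E| = 0)%E.
  rewrite -[LHS]fineK; first by congr EFin; rewrite -[RHS]h3.
  have /integrable_fin_num := integrable_norm iphi2; exact.
apply: filterS => x /(_ Logic.I) /= [].
move/eqP; rewrite mulf_eq0 orbb => /eqP phx.
by have := phiz x; rewrite phx /z; lra.
Qed.

Lemma ratio_GV_bounds t x :
  0 <= G t.+1 x ^+ 2 / V t.+1 x / s t x <= D1^-1 / Num.sqrt nu0.
Proof.
have sV0 : 0 <= (s t x)^-1 by rewrite invr_ge0 ltW.
have GV0 : 0 <= G t.+1 x ^+ 2 / V t.+1 x by rewrite divr_ge0 ?sqr_ge0.
rewrite mulr_ge0//= ler_pM ?inv_s_le//.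
have [V0|V0] := eqVneq (V t.+1 x) 0.
  by rewrite V0 invr0 mulr0 invr_ge0 ltW.
have Vp : 0 < V t.+1 x by rewrite lt0r V0 V_ge0.
rewrite ler_pdivrMr//.
have -> : G t.+1 x ^+ 2 = D1^-1 * (D1 * G t.+1 x ^+ 2).
  by rewrite mulKf// gt_eqF.
by rewrite ler_wpM2l ?invr_ge0 ?(ltW D1_gt0)// lerDr.
Qed.

(* Tested against G^2 / (V s), the second moment bound E[|g|^2 | F] <= V replaces
   a conditional Cauchy-Schwarz inequality.  When V = 0 also G = 0, and the junk
   value 0 of the quotient is the right one. *)
Lemma V_ratio_GV t x :
  V t.+1 x * (G t.+1 x ^+ 2 / V t.+1 x / s t x) = G t.+1 x ^+ 2 / s t x.
Proof.
have s0 : s t x != 0 by rewrite gt_eqF.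
have [V0|V0] := eqVneq (V t.+1 x) 0; last by field; rewrite V0 s0.
have GV0 : 0 <= D1 * G t.+1 x ^+ 2 by rewrite mulr_ge0 ?sqr_ge0// ltW.
suff -> : G t.+1 x = 0 by rewrite expr0n/= !mul0r mulr0.
move/eqP: V0; rewrite /V paddr_eq0//.
by rewrite mulf_eq0 (gt_eqF D1_gt0)/= sqrf_eq0 => /andP[_ /eqP].
Qed.

Lemma integrable_nu t : Int (nu t).
Proof.
elim: t => [|t IH].
  rewrite (_ : nu 0%N = fun=> nu0); first exact: integrable_cstR.
  by apply/funext => x; rewrite (adagrad_nu0 w_adagrad).
rewrite (_ : nu t.+1 = fun x => nu t x + u t.+1 x ^+ 2); last first.
  by apply/funext => x; rewrite nuS.
by apply: integrableDR => //; exact: integrable_sqr_u.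
Qed.

Lemma integrable_s t : Int (s t).
Proof.
have i1 : Int (fun x => 1 + nu t x).
  by apply: integrableDR; [exact: integrable_cstR|exact: integrable_nu].
apply: le_integrable i1 => //.
  exact/measurable_EFinP/(measurable_adapted (@s_adapted t)).
move=> x _ /=; rewrite lee_fin.
have s0 := ltW (s_gt0 t x); have := sqr_s t x; have nu0' := nu_ge0 t x.
rewrite !ger0_norm ?addr_ge0// => <-.
by have := sqr_ge0 (s t x - 1); have := sqr_ge0 (s t x); rewrite sqrrB; lra.
Qed.

(** * Expectations of the weighted gradient sum and of the conditioner *)

Let GS i x := G i.+1 x ^+ 2 / s i x.
Let X T x := \sum_(i < T) GS i x.
Let W T x := \sum_(i < T) u i.+1 x ^+ 2 * (G i.+1 x ^+ 2 / V i.+1 x / s i x).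

Let GS_ge0 i x : 0 <= GS i x.
Proof. by rewrite divr_ge0 ?sqr_ge0// ltW. Qed.

Let inv_s_bounds i x : 0 <= (s i x)^-1 <= (Num.sqrt nu0)^-1.
Proof. by rewrite inv_s_le andbT invr_ge0 ltW. Qed.

Lemma integrable_GS i : Int (GS i).
Proof.
have [K K0 GK] := grad_le i.
have mGS : measurable_fun [set: TF i.+1] (GS i : TF i.+1 -> R).
  by apply: measurable_funM => //; exact: inv_s_adapted.
apply: (@integrable_bounded _ _ _ _ (K ^+ 2 * (Num.sqrt nu0)^-1)).
  exact: measurable_adapted mGS.
move=> x; rewrite ger0_norm//; have /andP[a1 a2] := inv_s_bounds i x.
by apply: ler_pM => //; rewrite ?sqr_ge0// ler_sqr ?nnegrE ?enorm_ge0.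
Qed.

Lemma integrable_X T : Int (X T).
Proof. by apply: integrable_sumR => i; exact: integrable_GS. Qed.

Lemma expectation_X T : E (X T) = \sum_(i < T) E (GS i).
Proof. by rewrite /X Rintegral_sumR// => i; exact: integrable_GS. Qed.

Lemma expectation_W_le T : Int (W T) /\ E (W T) <= E (X T).
Proof.
have step i : Int (fun x => u i.+1 x ^+ 2 * (G i.+1 x ^+ 2 / V i.+1 x / s i x)) /\
    E (fun x => u i.+1 x ^+ 2 * (G i.+1 x ^+ 2 / V i.+1 x / s i x)) <= E (GS i).
  have mphi : measurable_fun [set: TF i.+1]
      ((fun x => G i.+1 x ^+ 2 / V i.+1 x / s i x) : TF i.+1 -> R).
    apply: measurable_funM (@inv_s_adapted i).
    apply: measurable_funM (@sqr_G_adapted i) _.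
    exact: measurable_inv_ge0 (@V_adapted i) _.
  have [h1 h2] := expectation_sqr_u_le mphi (ratio_GV_bounds i); split=> //.
  apply: le_trans h2 _; rewrite le_eqVlt; apply/orP; left; apply/eqP.
  by apply: eq_Rintegral => x _; rewrite V_ratio_GV.
split; first by apply: integrable_sumR => i; case: (step i).
rewrite /W Rintegral_sumR; last by move=> i; case: (step i).
rewrite expectation_X.
by apply: ler_sum => i _; case: (step i).
Qed.

Lemma expectation_s_le T : (1 <= T)%N ->
  E (s T) <= Num.sqrt nu0 + 2 * Num.sqrt (D0 * T%:R) + D1 * E (X T).
Proof.
move=> T1; set D := D0 * T%:R.
have T0 : 0 < (T%:R : R) by rewrite ltr0n.
have D_ge0 : 0 <= D by rewrite mulr_ge0// ltW.
pose phi i x := (Num.sqrt (nu i x + D))^-1.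
(* Bound on [D0 * phi i]; [T] such terms add up to [Num.sqrt D]. The other [Num.sqrt D] in the
   statement comes from the initial value [Num.sqrt (nu0 + D)]. *)
pose q := Num.sqrt D0 / Num.sqrt T%:R.
have B0 i x : 0 < nu i x + D by rewrite ltr_pwDl.
have phi_le i x : 0 <= phi i x <= (s i x)^-1.
  rewrite invr_ge0 sqrtr_ge0/= lef_pV2 ?posrE ?sqrtr_gt0//.
  by rewrite ler_wsqrtr// lerDl.
have mphi i : measurable_fun [set: TF i.+1] (phi i : TF i.+1 -> R).
  apply: measurable_inv_ge0 => [|x]; last exact: sqrtr_ge0.
  apply: measurable_sqrt_ge0 => [|x]; last exact: ltW.
  by apply: measurable_funD => //; exact: nu_adapted.
have step i : Int (fun x => u i.+1 x ^+ 2 * phi i x) /\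
    E (fun x => u i.+1 x ^+ 2 * phi i x) <= q + D1 * E (GS i).
  have bphi x : 0 <= phi i x <= (Num.sqrt nu0)^-1.
    have /andP[-> /=] := phi_le i x; move/le_trans; apply; exact: inv_s_le.
  have [h1 h2] := expectation_sqr_u_le (mphi i) bphi; split => //.
  apply: le_trans h2 _.
  have iR : Int (fun x => D1 * GS i x) by exact/integrableZR/integrable_GS.
  have -> : q + D1 * E (GS i) = E (fun x => q + D1 * GS i x).
    rewrite RintegralD//; last exact: integrable_cstR.
    by rewrite Rintegral_cstT RintegralZl//; exact: integrable_GS.
  have [K VK] := V_bounded i.
  apply: le_Rintegral => //.
  - apply: (integrable_boundedM (measurable_adapted (@V_adapted i)) VK).
    apply: (@integrable_bounded _ _ _ _ (Num.sqrt nu0)^-1).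
      exact: measurable_adapted (mphi i).
    by move=> x; have /andP[? ?] := bphi x; rewrite ger0_norm.
  - by apply: integrableDR => //; exact: integrable_cstR.
  - move=> x _; have /andP[p0 ps] := phi_le i x.
    (* The two parts of [V] use different bounds on [phi i]: [1 / s i] for the gradient part,
       [1 / sqrt D] for [D0]. *)
    rewrite /V mulrDl lerD//; last first.
      rewrite -mulrA ler_wpM2l ?(ltW D1_gt0)//.
      by rewrite ler_wpM2l ?sqr_ge0.
    rewrite ler_pdivrMr ?sqrtr_gt0//.
    have : Num.sqrt D <= Num.sqrt (nu i x + D) by rewrite ler_wsqrtr// lerDr.
    have q0 : 0 <= q by rewrite divr_ge0 ?sqrtr_ge0.
    move/(ler_wpM2l q0); apply: le_trans.
    rewrite /q /D sqrtrM// [_ * Num.sqrt T%:R]mulrC mulrA divfK; last first.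
      by rewrite gt_eqF// sqrtr_gt0.
    by rewrite -expr2 sqr_sqrtr.
pose RHS x := Num.sqrt (nu0 + D) + \sum_(i < T) u i.+1 x ^+ 2 * phi i x.
have iS : Int (fun x => \sum_(i < T) u i.+1 x ^+ 2 * phi i x).
  by apply: integrable_sumR => i; case: (step i).
have iRHS : Int RHS by apply: integrableDR => //; exact: integrable_cstR.
have h : E (s T) <= E RHS.
  apply: le_Rintegral => // [|x _]; first exact: integrable_s.
  apply: (@le_trans _ _ (Num.sqrt (nu T x + D))).
    by rewrite ler_wsqrtr// lerDl.
  have := @sqrt_nu_le _ (fun t => u t x) (fun t => nu t x) _ _ D T D_ge0.
  rewrite /= (adagrad_nu0 w_adagrad); apply=> // t; exact: nuS.
apply: le_trans h _.
rewrite /RHS RintegralD//; last exact: integrable_cstR.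
rewrite Rintegral_cstT Rintegral_sumR; last by move=> i; case: (step i).
have h2 : \sum_(i < T) E (fun x => u i.+1 x ^+ 2 * phi i x) <=
    \sum_(i < T) (q + D1 * E (GS i)) by apply: ler_sum => i _; case: (step i).
have h3 : \sum_(i < T) (q + D1 * E (GS i)) = Num.sqrt D + D1 * E (X T).
  rewrite big_split/= expectation_X mulr_sumr.
  congr (_ + _); rewrite sumr_const card_ord -mulr_natr /q /D sqrtrM//.
  rewrite -mulrA; congr (_ * _).
  by rewrite -[X in _ * X](sqr_sqrtr (ltW T0)) expr2 mulKf// gt_eqF// sqrtr_gt0.
have h4 : Num.sqrt (nu0 + D) <= Num.sqrt nu0 + Num.sqrt D.
  rewrite -ler_sqr ?nnegrE ?addr_ge0 ?sqrtr_ge0// sqrrD.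
  rewrite !sqr_sqrtr ?addr_ge0// ?(ltW nu0_gt0)//.
  have := mulr_ge0 (sqrtr_ge0 nu0) (sqrtr_ge0 D); lra.
by lra.
Qed.

(** * Expected trajectory bound under smoothness along the iterates *)

Section SmoothTrajectory.
Variables (a b m : R).
Hypotheses (a_ge0 : 0 <= a) (b_ge0 : 0 <= b).
Hypotheses (a_eta : a * eta <= 1 / 64) (a_eta_D1 : D1 * (a * eta) <= 1 / 64).
Hypothesis f_diff : forall v, differentiable f v.
Hypothesis f_ge : forall v, m <= f v.
(** The first clause feeds [descent] and has its constant at the start of the step; the second feeds
    [G_lip], where the constant sits at the end of the step. *)
Hypothesis smooth_trajectory : {ae P, forall x, forall t,
  (forall y, enorm (y - w t.+1 x) <= enorm (w t.+2 x - w t.+1 x) ->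
    enorm (grad f y - grad f (w t.+1 x)) <=
      (a * G t.+1 x + b) * enorm (y - w t.+1 x)) /\
  enorm (grad f (w t.+2 x) - grad f (w t.+1 x)) <=
    (a * G t.+2 x + b) * enorm (w t.+2 x - w t.+1 x)}.

(** [C0] and [C1] are the intercept and slope of [trajectory_bound], with its weight [k] written
    out; neither depends on [T]. *)
Let C0 := f w1 - m +
  eta * (33 / 32) * ((D0 + D1 * enorm (grad f w1) ^+ 2) / Num.sqrt nu0).
Let C1 := b * eta ^+ 2 + eta * (33 / 32) * (D1 *
  (b ^+ 2 * eta ^+ 2 / (1 / (32 * (D1 + 1))) / Num.sqrt nu0)).

Lemma intercept_ge0 : 0 <= C0.
Proof.
rewrite addr_ge0 ?subr_ge0 ?f_ge// !mulr_ge0 ?invr_ge0 ?sqrtr_ge0 ?(ltW eta_gt0)//.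
by rewrite addr_ge0// mulr_ge0 ?sqr_ge0// ltW.
Qed.

Lemma slope_ge0 : 0 <= C1.
Proof.
have D10 : 0 <= D1 by exact: ltW.
have e0 : 0 <= eta by exact: ltW.
by rewrite /C1 addr_ge0// !mulr_ge0 ?invr_ge0 ?sqrtr_ge0 ?sqr_ge0//
  !mulr_ge0 ?invr_ge0 ?mulr_ge0 ?addr_ge0.
Qed.

Lemma expectation_X_le (c : R) T : 0 < c ->
  eta * E (X T) <=
    C0 + C1 * (2 * (ln c + E (s T) / (Num.sqrt nu0 * c) - 1)) +
    eta * (33 / 32) * (1 / 4 * E (X T) + 1 / 16 * E (X T)).
Proof.
move=> c0; have [iW EW] := expectation_W_le T; have iX := integrable_X T.
have is_ := integrable_s T.
pose p i x := (s i x)^-1 * dotv (grad f (w i.+1 x)) (g i.+1 x).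
have Ep i : Int (p i) /\ E (p i) = E (GS i).
  have bs x : `|(s i x)^-1| <= (Num.sqrt nu0)^-1.
    by have /andP[? ?] := inv_s_bounds i x; rewrite ger0_norm.
  have [h1 h2] := expectation_dot (@inv_s_adapted i) bs; split; first exact: h1.
  rewrite /p h2; apply: eq_Rintegral => x _; exact: mulrC.
pose LHS x := eta * \sum_(i < T) p i x.
have iS : Int (fun x => \sum_(i < T) p i x).
  by apply: integrable_sumR => i; case: (Ep i).
have ELHS : E LHS = eta * E (X T).
  rewrite /LHS RintegralZl//; congr (_ * _).
  rewrite Rintegral_sumR; last by move=> i; case: (Ep i).
  rewrite expectation_X.
  by apply: eq_bigr => i _; case: (Ep i).
pose c1 := C0 + C1 * (2 * (ln c - 1)).
pose c2 := C1 * 2 / (Num.sqrt nu0 * c).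
pose e := eta * (33 / 32).
pose RHS x := c1 + (c2 * s T x + (e * (1 / 4) * W T x + e * (1 / 16) * X T x)).
have i1 : Int (fun x => e * (1 / 4) * W T x) by exact: integrableZR.
have i2 : Int (fun x => e * (1 / 16) * X T x) by exact: integrableZR.
have i3 : Int (fun x => c2 * s T x) by exact: integrableZR.
have i12 := integrableDR i1 i2; have i123 := integrableDR i3 i12.
have iRHS : Int RHS := integrableDR (integrable_cstR P c1) i123.
have ERHS : E RHS =
    c1 + (c2 * E (s T) + (e * (1 / 4) * E (W T) + e * (1 / 16) * E (X T))).
  rewrite /RHS RintegralD//; last exact: integrable_cstR.
  by rewrite Rintegral_cstT RintegralD// RintegralD// !RintegralZl.
have LR : E LHS <= E RHS.
  apply: ae_le_Rintegral => //; first exact: integrableZR.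
  apply: filterS smooth_trajectory => x smx.
  have := @trajectory_bound R eta a b D0 D1 m (fun t => f (w t x))
    (fun t => G t x) (fun t => dotv (grad f (w t x)) (g t x)) (fun t => u t x)
    (fun t => nu t x) eta_gt0 a_ge0 b_ge0 D0_ge0 D1_gt0 a_eta a_eta_D1.
  rewrite /= (adagrad_nu0 w_adagrad) (adagrad_w1 w_adagrad).
  move=> /(_ nu0_gt0 (fun t => nuS t x) (fun t => enorm_ge0 _)
    (fun t => enorm_ge0 _) (fun t => dotv_le_enorm _ _) (fun t => f_ge _)) H.
  have {H} := H _ _ c T c0.
  rewrite -/C1 /G (adagrad_w1 w_adagrad) -/C0 => H.
  have -> : LHS x = \sum_(i < T)
      eta * dotv (grad f (w i.+1 x)) (g i.+1 x) / Num.sqrt (nu i x).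
    rewrite /LHS mulr_sumr; apply: eq_bigr => i _.
    by rewrite /p mulrCA mulrC.
  apply: le_trans (H _ _) _.
  - move=> t; rewrite -enorm_step; have [sm _] := smx t.
    have := descent f_diff sm.
    have -> : dotv (grad f (w t.+1 x)) (w t.+2 x - w t.+1 x) =
        - (eta * dotv (grad f (w t.+1 x)) (g t.+1 x) / Num.sqrt (nu t.+1 x)).
      rewrite [w t.+2 x](adagrad_w w_adagrad)// addrC addKr -scaleNr dotvZr.
      by rewrite mulNr mulrAC.
    by [].
  - move=> t; rewrite -enorm_step; have [_ sm] := smx t.
    apply: le_trans sm; have := ler_enormD (grad f (w t.+2 x) - grad f (w t.+1 x))
      (grad f (w t.+1 x)).
    by rewrite subrK; lra.
  rewrite /RHS /c1 /c2 -/(s T x) -/(W T x) -/(X T x) -/e.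
  rewrite le_eqVlt; apply/orP; left; apply/eqP; ring.
rewrite ELHS ERHS in LR; apply: le_trans LR _.
have e0 : 0 <= e * (1 / 4) by rewrite !mulr_ge0// ltW.
have := ler_wpM2l e0 EW; rewrite /c1 /c2 -/e.
have -> : C1 * (2 * (ln c + E (s T) / (Num.sqrt nu0 * c) - 1)) =
  C1 * (2 * (ln c - 1)) + C1 * 2 / (Num.sqrt nu0 * c) * E (s T) by ring.
by lra.
Qed.

End SmoothTrajectory.

(* If D1 >= 1, the hypothesis on eta makes each step shorter than 1 / L1 and
   the local smoothness applies as is.  If D1 < 1, steps may be longer than
   1 / L1, but then ||grad f (w t)||^2 <= D0 / (1 - D1) almost surely, so that
   chaining gives Lipschitz gradients along the trajectory. *)
Lemma exists_smooth_trajectory : D1 * (L1 * eta) <= 1 / 64 ->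
  exists a b : R, [/\ 0 <= a, 0 <= b, a * eta <= 1 / 64,
    D1 * (a * eta) <= 1 / 64 &
    {ae P, forall x, forall t,
      (forall y, enorm (y - w t.+1 x) <= enorm (w t.+2 x - w t.+1 x) ->
        enorm (grad f y - grad f (w t.+1 x)) <=
          (a * G t.+1 x + b) * enorm (y - w t.+1 x)) /\
      enorm (grad f (w t.+2 x) - grad f (w t.+1 x)) <=
        (a * G t.+2 x + b) * enorm (w t.+2 x - w t.+1 x)}].
Proof.
move=> eta_D1; have [D1_ge1|D1_lt1] := leP 1 D1.
  have Le0 : 0 <= L1 * eta by rewrite mulr_ge0// ltW.
  have Le : L1 * eta <= 1 / 64 by apply: le_trans eta_D1; rewrite ler_peMl.
  exists L1, L0; split; rewrite ?(ltW L1_gt0) ?(ltW L0_gt0)//.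
  have eta_le : eta <= 1 / L1 by rewrite ler_pdivlMr// mulrC; lra.
  apply: aeW => x t; have st := le_trans (enorm_step_le t x) eta_le.
  split=> [y yw|]; last exact: f_smooth.
  rewrite [leLHS]enormB [X in _ <= _ * X]enormB; apply: f_smooth.
  by rewrite enormB (le_trans yw).
have q0 : 0 < 1 - D1 by rewrite subr_gt0.
pose Gam := Num.sqrt (D0 / (1 - D1)).
pose m := (Num.truncn (eta * L1)).+1.
have h0 : 0 <= 2 ^+ m * (L1 * Gam + L0).
  by rewrite mulr_ge0 ?exprn_ge0// addr_ge0 ?mulr_ge0 ?sqrtr_ge0// ltW.
(* The gradient bound [Gam] moves the whole Lipschitz constant into [b]; with [a = 0] the smallness
   conditions are immediate. *)
exists 0, (2 ^+ m * (L1 * Gam + L0)); split => //.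
- by rewrite mul0r; lra.
- by rewrite mul0r mulr0; lra.
(* Countably many null sets, one for each time, are merged into one. *)
have /ae_foralln := ae_sqr_grad_le; apply: filterS => x bx.
have GGam t : G t.+1 x <= Gam.
  rewrite -ler_sqr ?nnegrE ?enorm_ge0 ?sqrtr_ge0// [Gam ^+ 2]sqr_sqrtr.
    by rewrite ler_pdivlMr// mulrC.
  by rewrite divr_ge0// ltW.
have eta_m : eta <= m%:R / L1 by rewrite ler_pdivlMr// ltW// truncnS_gt.
have lip t y : enorm (w t.+1 x - y) <= eta ->
    enorm (grad f (w t.+1 x) - grad f y) <=
      2 ^+ m * (L1 * Gam + L0) * enorm (w t.+1 x - y).
  move=> yw; have := smooth_chain L0_gt0 L1_gt0 f_smooth (le_trans yw eta_m).
  move/le_trans; apply; rewrite ler_wpM2r ?enorm_ge0// ler_wpM2l ?exprn_ge0//.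
  by rewrite lerD2r ler_wpM2l ?(ltW L1_gt0)//; exact: GGam.
move=> t; split=> [y yw|]; rewrite mul0r add0r.
  rewrite [leLHS]enormB [X in _ <= _ * X]enormB; apply: lip.
  by rewrite enormB (le_trans yw)// enorm_step_le.
exact/lip/enorm_step_le.
Qed.

Lemma measurable_min_sq_grad T :
  measurable_fun [set: Omega] (fun x => min_sq_grad f (fun t => w t x) T).
Proof.
have mG t : measurable_fun [set: Omega] (fun x => enorm (grad f (w t.+1 x)) ^+ 2).
  exact: measurable_adapted (@sqr_G_adapted t).
rewrite /min_sq_grad; under eq_fun do rewrite big_add1/= big_mkord.
suff H (z : Omega -> R) (Z : nat -> Omega -> R) : measurable_fun [set: Omega] z ->
    (forall t, measurable_fun [set: Omega] (Z t)) ->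
    measurable_fun [set: Omega] (fun x => \big[Num.min/z x]_(i < T) Z i x).
  exact: (H _ _ (mG 0%N) mG).
move=> mz; elim: T Z => [|T IH] Z mZ; first by under eq_fun do rewrite big_ord0.
under eq_fun do rewrite big_ord_recl.
by apply: measurable_minr => //; exact: (IH (fun t => Z t.+1)).
Qed.

(* T min <= s_T X_T, and s_T X_T / (A B) <= ((s_T / A + X_T / B) / 2)^2, whose
   square root has expectation at most 1. *)
Lemma min_sq_grad_whp (A B delta : R) T : (1 <= T)%N -> 0 < A -> 0 < B ->
  0 < delta -> E (s T) <= A -> E (X T) <= B ->
  ((1 - delta)%:E <= P [set x |
    (min_sq_grad f (fun t => w t x) T <= A * B / (T%:R * delta ^+ 2))%R])%E.
Proof.
move=> T1 A0 B0 d0 EA EB.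
have iS := integrable_s T; have iX := integrable_X T.
pose Y x := (2 * A)^-1 * s T x + (2 * B)^-1 * X T x.
have i1 : Int (fun x => (2 * A)^-1 * s T x) by exact: integrableZR.
have i2 : Int (fun x => (2 * B)^-1 * X T x) by exact: integrableZR.
have X0 x : 0 <= X T x by apply: sumr_ge0 => i _; exact: GS_ge0.
have Y0 x : 0 <= Y x.
  by rewrite addr_ge0// mulr_ge0 ?invr_ge0 ?sqrtr_ge0 ?X0// mulr_ge0// ltW.
have EY : E Y <= 1.
  rewrite /Y RintegralD// !RintegralZl//.
  have : (2 * A)^-1 * E (s T) <= 1 / 2.
    by rewrite mulrC ler_pdivrMr ?mulr_gt0//; lra.
  have : (2 * B)^-1 * E (X T) <= 1 / 2.
    by rewrite mulrC ler_pdivrMr ?mulr_gt0//; lra.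
  lra.
apply: le_trans (markov_le1 (integrableDR i1 i2) Y0 EY d0) _.
have mY : measurable_fun [set: Omega] Y.
  exact/measurable_EFinP/measurable_int/(integrableDR i1 i2).
have meas_le (Z : Omega -> R) c : measurable_fun [set: Omega] Z ->
    measurable [set x | Z x <= c].
  move=> mZ; rewrite (_ : [set x | _] = Z @^-1` `]-oo, c]).
    by rewrite -[_ @^-1` _]setTI; apply: mZ => //; exact: measurable_itv.
  by apply/seteqP; split => x /=; rewrite in_itv.
apply: le_measure; rewrite ?inE.
- exact: meas_le.
- exact/meas_le/measurable_min_sq_grad.
move=> x /= Yx; set mn := min_sq_grad _ _ _.
have T0 : 0 < (T%:R : R) by rewrite ltr0n.
rewrite ler_pdivlMr ?mulr_gt0 ?exprn_gt0//.
have sT0 := s_gt0 T x.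
(* Each of the [T] terms of [X T x] is at least [mn / s T x], as [s] is nondecreasing and
   [mn >= 0]. *)
have mnX : T%:R * mn <= s T x * X T x.
  rewrite [leRHS]mulrC -ler_pdivrMr// /X.
  have -> : T%:R * mn / s T x = \sum_(i < T) mn / s T x.
    by rewrite sumr_const card_ord -mulr_natr; ring.
  apply: ler_sum => i _; rewrite /GS; apply: ler_pM.
  - rewrite /mn /min_sq_grad; elim/big_ind : _ => [|p q p0 q0|j _].
    + exact: sqr_ge0.
    + by rewrite le_min p0.
    + exact: sqr_ge0.
  - by rewrite invr_ge0 ltW.
  - exact: min_sq_grad_le.
  - rewrite lef_pV2 ?posrE// ler_wsqrtr//.
    by rewrite nu_le// ltnW.
have YY : Y x * delta <= 1 by rewrite -ler_pdivlMr// mul1r.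
have Yd0 : 0 <= Y x * delta by rewrite mulr_ge0// ltW.
have Y2 : (Y x * delta) ^+ 2 <= 1 by rewrite expr_le1.
have AB0 : 0 < A * B by rewrite mulr_gt0.
have sXY : s T x * X T x <= A * B * Y x ^+ 2.
  rewrite -subr_ge0; have -> : A * B * Y x ^+ 2 - s T x * X T x =
      A * B * ((2 * A)^-1 * s T x - (2 * B)^-1 * X T x) ^+ 2.
    by rewrite /Y; field; rewrite !gt_eqF.
  by rewrite mulr_ge0 ?sqr_ge0// ltW.
have d2 : 0 <= delta ^+ 2 by exact: sqr_ge0.
have h1 := ler_wpM2r d2 (le_trans mnX sXY).
have h2 : A * B * (Y x ^+ 2 * delta ^+ 2) <= A * B.
  by rewrite -exprMn ler_piMr// ltW.
have -> : mn * (T%:R * delta ^+ 2) = T%:R * mn * delta ^+ 2 by ring.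
by apply: le_trans h1 _; rewrite -(mulrA (A * B)).
Qed.

End AdaGradNorm.

Theorem theorem8 (R : realType) (n : nat) (f : 'rV[R]_n -> R) (L0 L1 : R)
  (d : measure_display) (Omega : measurableType d) (P : probability Omega R)
  (eta nu0 D0 D1 : R) (w1 : 'rV[R]_n)
  (g : nat -> Omega -> 'rV[R]_n) (nu : nat -> Omega -> R)
  (w : nat -> Omega -> 'rV[R]_n)
  (f_differentiable : forall u, differentiable f u)
  (f_bounded_below : exists m : R, forall u, m <= f u)
  (L0_gt0 : 0 < L0) (L1_gt0 : 0 < L1)
  (f_smooth : forall u v : 'rV[R]_n, enorm (u - v) <= 1 / L1 ->
     enorm (grad f u - grad f v) <=
       (L1 * enorm (grad f u) + L0) * enorm (u - v))
  (nu0_gt0 : 0 < nu0)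
  (g_random : forall t, (1 <= t)%N -> random_vector (g t))
  (w_adagrad : adagrad_norm eta w1 nu0 g nu w)
  (D0_ge0 : 0 <= D0) (D1_gt0 : 0 < D1)
  (g_unbiased : forall t, (1 <= t)%N -> forall i : 'I_n,
     is_cond_exp P (grad_filtration g t)
       (fun x => g t x ord0 i) (fun x => grad f (w t x) ord0 i))
  (g_affine_variance : forall t, (1 <= t)%N ->
     exists2 V : Omega -> R,
       is_cond_exp P (grad_filtration g t) (fun x => enorm (g t x) ^+ 2) V &
       {ae P, forall x, V x <= D0 + D1 * enorm (grad f (w t x)) ^+ 2})
  (eta_gt0 : 0 < eta)
  (eta_lt : eta <
     1 / L1 * Num.min (1 / (64 * D1)) (1 / (8 * Num.sqrt D1))) :
  exists C : R, forall (T : nat) (delta : R), (1 <= T)%N ->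
    0 < delta -> delta < 1 ->
    ((1 - delta)%:E <=
     P [set x | (min_sq_grad f (fun t => w t x) T <=
          C * ((1 + ln (1 + Num.sqrt (D0 * T%:R))) / (T%:R * delta ^+ 2)) +
          C * (Num.sqrt D0 * (1 + ln (1 + Num.sqrt (D0 * T%:R))) /
               (Num.sqrt T%:R * delta ^+ 2)))%R])%E.
Proof.
have [m f_ge] := f_bounded_below.
have D1e : D1 * (L1 * eta) <= 1 / 64.
  have D64 : 0 < 64 * D1 by rewrite mulr_gt0.
  have eta_le : eta <= 1 / L1 * (1 / (64 * D1)).
    apply: le_trans (ltW eta_lt) _; apply: ler_wpM2l; last by rewrite ge_min lexx.
    by rewrite divr_ge0// ltW.
  have DL0 : 0 <= D1 * L1 by rewrite mulr_ge0// ltW.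
  rewrite mulrA; apply: le_trans (ler_wpM2l DL0 eta_le) _.
  by rewrite le_eqVlt; apply/orP; left; apply/eqP; field; rewrite !gt_eqF.
have [a [b [a0 b0 ae aeD smooth]]] := exists_smooth_trajectory L0_gt0 L1_gt0
  f_smooth nu0_gt0 g_random w_adagrad D0_ge0 D1_gt0 eta_gt0 g_unbiased
  g_affine_variance D1e.
have s0 : 0 < Num.sqrt nu0 by rewrite sqrtr_gt0.
have [A [B [A0 B0 AB]]] := moment_bootstrap s0 D1_gt0 eta_gt0
  (intercept_ge0 nu0 w1 D0_ge0 D1_gt0 eta_gt0 f_ge) (slope_ge0 nu0 D1_gt0 eta_gt0 b0).
(* [A] and [B] are obtained before [r], the only quantity through which [T] enters the moment
   bounds. *)
exists (A * B) => T delta T1 d0 _.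
set r := Num.sqrt (D0 * T%:R).
have r0 : 0 <= r := sqrtr_ge0 _.
have S0 : 0 <= \int[P]_x Num.sqrt (nu T x).
  by apply: Rintegral_ge0 => x _; exact: sqrtr_ge0.
have X0 : 0 <= \int[P]_x \sum_(i < T)
    enorm (grad f (w i.+1 x)) ^+ 2 / Num.sqrt (nu i x).
  apply: Rintegral_ge0 => x _; apply: sumr_ge0 => i _.
  by rewrite divr_ge0 ?sqr_ge0 ?sqrtr_ge0.
have [ES EX] := AB r _ _ r0 X0 S0
  (fun c c0 => expectation_X_le L0_gt0 L1_gt0 f_smooth nu0_gt0 g_random
    w_adagrad D0_ge0 D1_gt0 eta_gt0 g_unbiased g_affine_variance a0 b0 ae aeD
    f_differentiable f_ge smooth T c0)
  (expectation_s_le L0_gt0 L1_gt0 f_smooth nu0_gt0 g_random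
    w_adagrad D0_ge0 D1_gt0 eta_gt0 g_unbiased g_affine_variance T1).
have l0 : 0 <= ln (1 + r) by rewrite ln_ge0// lerDl.
have A1 : 0 < A * (1 + r) by rewrite mulr_gt0//; lra.
have B1 : 0 < B * (1 + ln (1 + r)) by rewrite mulr_gt0//; lra.
have := min_sq_grad_whp L0_gt0 L1_gt0 f_smooth nu0_gt0 g_random w_adagrad
  eta_gt0 g_unbiased g_affine_variance T1 A1 B1 d0 ES EX.
have T0 : 0 < (T%:R : R) by rewrite ltr0n.
have sT0 : 0 < Num.sqrt (T%:R : R) by rewrite sqrtr_gt0.
have sT : Num.sqrt (T%:R : R) ^+ 2 = T%:R by rewrite sqr_sqrtr// ltW.
rewrite (_ : A * (1 + r) * (B * (1 + ln (1 + r))) / (T%:R * delta ^+ 2) =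
  A * B * ((1 + ln (1 + r)) / (T%:R * delta ^+ 2)) +
  A * B * (Num.sqrt D0 * (1 + ln (1 + r)) / (Num.sqrt T%:R * delta ^+ 2)))//.
(* With [q] for [Num.sqrt T%:R], [T] becomes [q ^+ 2] and [r] becomes [D * q], so the two terms of
   the rate are an exact splitting of the factor [1 + r]. *)
have split_bound (l D q : R) : 0 < q ->
    A * (1 + D * q) * (B * (1 + l)) / (q ^+ 2 * delta ^+ 2) =
    A * B * ((1 + l) / (q ^+ 2 * delta ^+ 2)) +
    A * B * (D * (1 + l) / (q * delta ^+ 2)).
  by move=> q0; field; rewrite !gt_eqF.
have := split_bound (ln (1 + r)) (Num.sqrt D0) _ sT0; rewrite sT => <-.
by rewrite -sqrtrM.
Qed.
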